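(* Let $\Omega\subset\mathbb{R}^n$, $n\in\{2,3\}$, be a bounded, connected Lipschitz domain. For a constant $K\in(0,1)$ consider the weak mixed Darcy problem: find $\mathbf{u}\in\mathbf{V}$, $p\in Q$ such that $$a(\mathbf{u},\mathbf{v})+b(\mathbf{v},p)=(\mathbf{f},\mathbf{v})\quad\forall\,\mathbf{v}\in\mathbf{V},\qquad b(\mathbf{u},q)=(g,q)\quad\forall\, q\in Q,$$ with $a(\mathbf{u},\mathbf{v})=(K^{-1}\mathbf{u},\mathbf{v})$ and $b(\mathbf{u},q)=(\nabla\cdot\mathbf{u},q)$, posed in the spaces $$\mathbf{V}=K^{-1/2}\mathbf{L}^2\cap\mathbf{H}_0(\operatorname{div}),\qquad Q=L^2/\mathbb{R}+K^{1/2}(H^1/\mathbb{R}).$$ Then the Brezzi conditions are satisfied uniformly in $K$. That is, there exist constants $C_a,C_b,\alpha,\beta>0$ independent of $K\in(0,1)$ such that, for every $K\in(0,1)$: (i) $|a(\mathbf{u},\mathbf{v})|\le C_a\|\mathbf{u}\|_{\mathbf{V}}\|\mathbf{v}\|_{\mathbf{V}}$ for all $\mathbf{u},\mathbf{v}\in\mathbf{V}$; (ii) $|b(\mathbf{v},q)|\le C_b\|\mathbf{v}\|_{\mathbf{V}}\|q\|_Q$ for all $\mathbf{v}\in\mathbf{V}$, $q\in Q$; (iii) $a(\mathbf{z},\mathbf{z})\ge\alpha\|\mathbf{z}\|_{\mathbf{V}}^2$ for all $\mathbf{z}\in\mathbf{Z}=\{\mathbf{z}\in\mathbf{V}: b(\mathbf{z},q)=0\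 \forall q\in Q\}$; (iv) $\displaystyle\sup_{0\ne\mathbf{v}\in\mathbf{V}}\frac{b(\mathbf{v},q)}{\|\mathbf{v}\|_{\mathbf{V}}}\ge\beta\|q\|_Q$ for all $q\in Q$.
   Context: $(\cdot,\cdot)$ is the $L^2(\Omega)$ inner product (for scalar or vector fields). $L^2/\mathbb{R}$ and $H^1/\mathbb{R}$ are the subspaces of $L^2(\Omega)$ and $H^1(\Omega)$ of functions with zero mean; $L^2/\mathbb{R}$ carries the $L^2$ norm and $H^1/\mathbb{R}$ the norm $\|\nabla q\|_{L^2}$ (equivalent to the full $H^1$ norm on zero-mean functions). $\mathbf{L}^2=L^2(\Omega)^n$. $\mathbf{H}_0(\operatorname{div})$ is the space of $\mathbf{v}\in\mathbf{L}^2$ with $\nabla\cdot\mathbf{v}\in L^2$ and zero normal trace on $\partial\Omega$, with $\|\mathbf{v}\|_{\mathbf{H}(\operatorname{div})}^2=\|\mathbf{v}\|_{L^2}^2+\|\nabla\cdot\mathbf{v}\|_{L^2}^2$. For a Hilbert space $X$ and $\alpha>0$, $\alpha X$ is the space $X$ with norm $\|f\|_{\alpha X}^2=\alpha^2\|f\|_X^2$. For Hilbert spaces $X,Y$ that are subspaces of a common larger Hilbert space, $X\cap Y$ has norm $\|z\|_{X\cap Y}^2=\|z\|_X^2+\|z\|_Y^2$, and $X+Y=\{x+y: x\in X,\ y\in Y\}$ has norm $\|z\|_{X+Y}^2=\inf_{z=x+y,\,x\in X,\,y\in Y}\left(\|x\|_X^2+\|y\|_Y^2\right)$. In particular $Q$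 coincides with $L^2/\mathbb{R}$ as a set, so $b$ is well defined on $\mathbf{V}\times Q$. *)

(* Defs.v *)
From HB Require Import structures.
From mathcomp Require Import all_boot all_order all_algebra.
From mathcomp Require Import all_classical all_reals all_analysis.

Set Implicit Arguments.
Unset Strict Implicit.
Unset Printing Implicit Defensive.

Import Order.TTheory GRing.Theory Num.Theory.
Import numFieldNormedType.Exports.

Local Open Scope classical_set_scope.
Local Open Scope ring_scope.

Definition rV_display : measure_display. Proof. exact: default_measure_display. Qed.

HB.instance Definition _ (R : realType) (n : nat) :=
  @isMeasurable.Build rV_display 'rV[R]_n <<s @open 'rV[R]_n >>
    (@sigma_algebra0 _ setT _) (@sigma_algebraC 'rV[R]_n _)
    (@sigma_algebra_bigcup _ setT _).

Lemma open_measurable_rV (R : realType) (n : nat) (A : set 'rV[R]_n) :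
  open A -> measurable A.
Proof. by move=> oA; exact: sub_sigma_algebra. Qed.

Definition rV_cons (R : realType) (n : nat) (p : 'rV[R]_n * measurableTypeR R) : 'rV[R]_n.+1 :=
  row_mx (p.2%:M : 'rV_1) p.1.

Lemma rV_cons0 (R : realType) (n : nat) (p : 'rV[R]_n * measurableTypeR R) i :
  rV_cons p i ord0 = p.2.
Proof.
have -> : ord0 = lshift n (ord0 : 'I_1) :> 'I_n.+1 by exact: val_inj.
by transitivity ((p.2%:M : 'rV_1) i ord0);
  [exact: (@row_mxEl _ 1 1 n)|rewrite (ord1 i) mxE eqxx].
Qed.

Lemma rV_consS (R : realType) (n : nat) (p : 'rV[R]_n * measurableTypeR R) i (j : 'I_n) :
  rV_cons p i (rshift 1 j) = p.1 i j.
Proof. exact: (@row_mxEr _ 1 1 n). Qed.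

Lemma rational_ball (R : realType) (n : nat) (A : set 'rV[R]_n) (x : 'rV[R]_n) :
  open A -> A x ->
  exists (q : 'rV[rat]_n) (k : nat),
    ball (map_mx ratr q : 'rV[R]_n) k.+1%:R^-1 x /\
    ball (map_mx ratr q : 'rV[R]_n) k.+1%:R^-1 `<=` A.
Proof.
move=> oA Ax.
have /nbhs_ballP[e /= e0 eA] : nbhs x A by exact: open_nbhs_nbhs.
have e20 : 0 < e / 2 by rewrite divr_gt0.
pose k := Num.truncn (e / 2)^-1.
have k0 : 0 < k.+1%:R^-1 :> R by rewrite invr_gt0 ltr0n.
have ke : k.+1%:R^-1 < e / 2.
  rewrite -[ltRHS]invrK ltf_pV2 ?posrE ?invr_gt0 ?ltr0n//.
  exact: truncnS_gt.
have qE i : exists q : rat, ball (x ord0 i) k.+1%:R^-1 (ratr q).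
  have [|y [xy [q _ qy]]] :=
      @dense_rat R _ (ex_intro _ (x ord0 i) (ballxx (x ord0 i) k0)).
    exact: ball_open.
  by exists q; rewrite qy.
have [f fE] := choice qE.
exists (\row_i f i), k.
have xB : ball (map_mx ratr (\row_i f i) : 'rV[R]_n) k.+1%:R^-1 x.
  by split=> // i j; rewrite !mxE (ord1 i); exact/ball_sym/fE.
split=> // y yB; apply: eA; rewrite [e]splitr.
apply: (@ball_triangle _ _ (map_mx ratr (\row_i f i) : 'rV[R]_n)).
  exact/ball_sym/(le_ball (ltW ke)).
exact: (le_ball (ltW ke)).
Qed.

Lemma measurable_rV_cons (R : realType) (n : nat) :
  measurable_fun [set: 'rV[R]_n * measurableTypeR R] (@rV_cons R n).
Proof.
apply: (measurability (@open 'rV[R]_n.+1)) => // _ [A oA <-]; rewrite setTI.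
pose I : countType := ('rV[rat]_n.+1 * nat)%type.
pose B (p : I) : set 'rV[R]_n.+1 := ball (map_mx ratr p.1 : 'rV[R]_n.+1) p.2.+1%:R^-1.
have -> : @rV_cons R n @^-1` A =
    \bigcup_(p in [set p : I | B p `<=` A]) (@rV_cons R n @^-1` B p).
  apply/seteqP; split=> [x Ax|x [p pA xp]]; last exact: pA.
  by have [q [k [qx qA]]] := rational_ball oA Ax; exists (q, k).
rewrite bigcup_mkcond.
apply: countable_bigcupT_measurable; first exact: countableP.
move=> p; case: ifPn => // _.
have -> : @rV_cons R n @^-1` B p =
    ball (map_mx ratr (rsubmx (p.1 : 'rV_(1 + n))) : 'rV[R]_n) p.2.+1%:R^-1 `*`
    ball (ratr (p.1 ord0 ord0) : R) p.2.+1%:R^-1.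
  apply/seteqP; split=> [[v t] /= [e0 H]|[v t] /= [[e0 H1] H2]].
    split.
      by split=> // i j; have := H i (rshift 1 j); rewrite rV_consS !mxE.
    by have := H ord0 ord0; rewrite rV_cons0 !mxE.
  split=> // i j; rewrite -(@splitK 1 n j) (ord1 i).
  case: (@fintype.split 1 n j) => k /=.
    have -> : lshift n k = ord0 :> 'I_n.+1 by rewrite (ord1 k); exact: val_inj.
    by rewrite rV_cons0 mxE.
  by rewrite rV_consS; have := H1 ord0 k; rewrite !mxE.
apply: measurableX.
  by apply: open_measurable_rV; apply: ball_open; rewrite invr_gt0 ltr0n.
apply: measurable_realfun.open_measurable.
by apply: ball_open; rewrite invr_gt0 ltr0n.
Qed.

Section leb.
Context (R : realType) (n : nat) (mu : {measure set 'rV[R]_n -> \bar R}).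

Definition leb_step : set 'rV[R]_n.+1 -> \bar R :=
  pushforward (mu \x @lebesgue_measure R)%E (@rV_cons R n).

Let mf := @measurable_rV_cons R n.

Let leb_step0 : leb_step set0 = 0%E. Proof. exact: measure0. Qed.

Let leb_step_ge0 A : (0 <= leb_step A)%E. Proof. exact: measure_ge0. Qed.

Let leb_step_sigma_additive : semi_sigma_additive leb_step.
Proof. exact: measure_semi_sigma_additive. Qed.

HB.instance Definition _ := isMeasure.Build _ _ _ leb_step
  leb_step0 leb_step_ge0 leb_step_sigma_additive.

End leb.

(* n-dimensional Lebesgue measure on the Borel sets, as an iterated product;
   [leb_box] below characterizes it. *)
Fixpoint leb (R : realType) (n : nat) : {measure set 'rV[R]_n -> \bar R} :=
  match n with
  | 0 => \d_(0 : 'rV[R]_0)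
  | m.+1 => leb_step (leb R m)
  end.

Lemma continuous_measurable_rV (R : realType) (n : nat) (f : 'rV[R]_n -> R) :
  continuous f -> measurable_fun setT f.
Proof.
move=> /continuousP cf.
apply: (measurability _ (measurable_realfun.RGenOpens.measurableE R)).
move=> _ [_ [x [y ->] <-]]; rewrite setTI.
by apply: open_measurable_rV; apply: cf; exact: interval_open.
Qed.

Lemma measurable_box (R : realType) (n : nat) (A : 'I_n -> set (measurableTypeR R)) :
  (forall i, measurable (A i)) ->
  measurable [set x : 'rV[R]_n | forall i, A i (x ord0 i)].
Proof.
move=> mA.
have -> : [set x : 'rV[R]_n | forall i, A i (x ord0 i)] =
    \bigcap_(i in [set: 'I_n]) ((fun x : 'rV[R]_n => x ord0 i) @^-1` A i).
  by apply/seteqP; split=> x /= H i; [move=> _|]; exact: H.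
apply: fin_bigcap_measurable => // i _; rewrite -[X in measurable X]setTI.
apply: (continuous_measurable_rV (@coord_continuous R 1 n ord0 i)) => //.
exact: mA.
Qed.

Lemma leb_box (R : realType) (n : nat) (A : 'I_n -> set (measurableTypeR R)) :
  (forall i, measurable (A i)) ->
  leb R n [set x : 'rV[R]_n | forall i, A i (x ord0 i)] =
  (\prod_(i < n) @lebesgue_measure R (A i))%E.
Proof.
elim: n A => [|n IH] A mA /=.
  by rewrite big_ord0 diracE mem_set// => -[].
rewrite big_ord_recl /leb_step /pushforward /=.
have -> : @rV_cons R n @^-1` [set x | forall i, A i (x ord0 i)] =
    [set x : 'rV[R]_n | forall i, A (lift ord0 i) (x ord0 i)] `*` A ord0.
  apply/seteqP; split=> [[v t] /= H|[v t] /= [H1 H0] i].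
    split; last by have := H ord0; rewrite rV_cons0.
    move=> i; have := H (lift ord0 i : 'I_n.+1).
    by rewrite (_ : lift ord0 i = rshift 1 i :> 'I_n.+1) ?rV_consS//; exact: val_inj.
  case: (unliftP ord0 i) => [j|] ->; last by rewrite rV_cons0.
  have -> : rV_cons (v, t) ord0 (lift ord0 j) = v ord0 j.
    by rewrite (_ : lift _ j = rshift 1 j :> 'I_n.+1) ?rV_consS//; exact: val_inj.
  exact: H1.
have mB i : measurable (A (lift ord0 i)) by exact: mA.
have mBox := measurable_box mB.
by rewrite product_measure1E// (IH _ mB) muleC.
Qed.

(* Near each boundary point, and in suitable orthonormal coordinates
   [x *m A], Omega is the region strictly above the graph of a Lipschitz
   function of the coordinates other than the [i]-th one. *)
Definition lipschitz_boundary (R : realType) (n : nat) (Omega : set 'rV[R]_n) :=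
  forall x0 : 'rV[R]_n, (closure Omega `\` Omega) x0 ->
  exists (A : 'M[R]_n) (i : 'I_n) (gamma : 'rV[R]_n.-1 -> R) (r : R),
    [/\ A *m A^T = 1%:M, lipschitz gamma, 0 < r &
        forall x : 'rV[R]_n, ball x0 r x ->
          (Omega x <-> gamma (col' i (x *m A)) < (x *m A) ord0 i)].

Record bounded_lipschitz_domain (R : realType) (n : nat)
    (Omega : set 'rV[R]_n) : Prop := BoundedLipschitzDomain {
  domain_open : open Omega;
  domain_nonempty : Omega !=set0;
  domain_connected : connected Omega;
  domain_bounded : bounded_set Omega;
  domain_lipschitz : lipschitz_boundary Omega }.

(* A linear subspace [carrier] of an ambient space [E] of fields, with its own
   norm. Fields are functions defined on all of R^n, of which only the
   restriction to Omega, up to equality almost everywhere, matters. *)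
Record nspace (R : realType) (E : Type) := NSpace {
  carrier : set E;
  norm : E -> R }.

Definition scale_space (R : realType) (E : Type) (alpha : R)
    (X : nspace R E) : nspace R E :=
  NSpace (carrier X) (fun f => alpha * norm X f).

Definition cap_space (R : realType) (E : Type) (X Y : nspace R E) : nspace R E :=
  NSpace (carrier X `&` carrier Y)
    (fun z => Num.sqrt (norm X z ^+ 2 + norm Y z ^+ 2)).

Section fields.
Context (R : realType) (n : nat) (Omega : set 'rV[R]_n).
Local Notation mu := (leb R n).
Local Notation sfield := ('rV[R]_n -> R).
Local Notation vfield := ('rV[R]_n -> 'rV[R]_n).
Implicit Types (f g q : sfield) (u v w : vfield).

Definition sum_space (X Y : nspace R sfield) : nspace R sfield :=
  let decomposition z (xy : sfield * sfield) :=
    [/\ carrier X xy.1, carrier Y xy.2 & ae_eq mu Omega z (xy.1 \+ xy.2)] in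
  NSpace [set z | exists xy, decomposition z xy]
    (fun z => Num.sqrt (inf
      [set norm X xy.1 ^+ 2 + norm Y xy.2 ^+ 2 | xy in decomposition z])).

Definition inner f g : R := \int[mu]_(x in Omega) (f x * g x).

Definition vinner v w : R :=
  \int[mu]_(x in Omega) (\sum_(i < n) v x ord0 i * w x ord0 i).

Definition L2 : set sfield := [set f | (f \_ Omega) \in Lfun mu 2%:E].

Definition vL2 : set vfield :=
  [set v | forall i, L2 (fun x => v x ord0 i)].

Definition partial (i : 'I_n) f : sfield := fun x => 'D_('e_i) f x.

Definition gradient f : vfield := fun x => \row_i partial i f x.

Definition smooth f := forall s : seq 'I_n,
  let df := foldr partial f s in
  continuous df /\ forall (i : 'I_n) x, derivable df x 'e_i.

Definition test_function f :=
  let support := closure [set x | f x != 0] in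
  [/\ smooth f, compact support & support `<=` Omega].

Definition is_weak_gradient f w := vL2 w /\
  forall phi i, test_function phi ->
    inner f (partial i phi) = - inner (fun x => w x ord0 i) phi.

Definition is_weak_divergence v f := L2 f /\
  forall phi, test_function phi -> vinner v (gradient phi) = - inner f phi.

(* Weak derivatives are unique up to almost everywhere equality; [wgrad] and
   [wdiv] pick a representative, and are 0 when there is none. *)
Definition wgrad f : vfield := xget (cst 0) [set w | is_weak_gradient f w].

Definition wdiv v : sfield := xget (cst 0) [set f | is_weak_divergence v f].

Definition H1 : set sfield := L2 `&` [set f | exists w, is_weak_gradient f w].

Definition Hdiv : set vfield := vL2 `&` [set v | exists f, is_weak_divergence v f].

(* The normal trace of [v] in H(div) is an element of the dual of the space of
   traces of H^1 functions; it is defined by Green's formula. *)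
Definition normal_trace v f : R := vinner v (wgrad f) + inner (wdiv v) f.

Definition zero_mean : set sfield := [set f | \int[mu]_(x in Omega) f x = 0].

Definition L2_zero_mean : nspace R sfield :=
  NSpace (L2 `&` zero_mean) (fun f => Num.sqrt (inner f f)).

Definition H1_zero_mean : nspace R sfield :=
  NSpace (H1 `&` zero_mean)
    (fun f => Num.sqrt (vinner (wgrad f) (wgrad f))).

Definition vL2_space : nspace R vfield :=
  NSpace vL2 (fun v => Num.sqrt (vinner v v)).

Definition H0div_space : nspace R vfield :=
  NSpace (Hdiv `&` [set v | forall f, H1 f -> normal_trace v f = 0])
    (fun v => Num.sqrt (vinner v v + inner (wdiv v) (wdiv v))).

Definition V_space (K : R) : nspace R vfield :=
  cap_space (scale_space (Num.sqrt K)^-1 vL2_space) H0div_space.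

Definition Q_space (K : R) : nspace R sfield :=
  sum_space L2_zero_mean (scale_space (Num.sqrt K) H1_zero_mean).

Definition darcy_a (K : R) u v : R := vinner (fun x => K^-1 *: u x) v.

Definition darcy_b u q : R := inner (wdiv u) q.

Definition Z_space (K : R) : set vfield :=
  [set z | carrier (V_space K) z /\
           forall q, carrier (Q_space K) q -> darcy_b z q = 0].

End fields.

(* Main.v *)
From HB Require Import structures.
Require Import Defs.
From mathcomp Require Import all_boot all_order all_algebra.
From mathcomp Require Import all_classical all_reals all_analysis.
From mathcomp Require Import measurable_realfun ring lra.

(* For the inf-sup condition (iv), given a zero-mean q, let y be the Riesz
   representative of r |-> (q, r) in H^1 for (y, r) + K (grad y, grad r), and put
   v = - K grad y. Testing with smooth r shows div v = q - y, testing with all r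
   in H^1 shows that the normal trace of v vanishes, and r = 1 shows that y has
   zero mean. Hence b(v, q) = |q - y|^2 + K |grad y|^2, which is at least
   |q|_Q^2 because q = (q - y) + y, while |v|_V^2 <= 2 b(v, q). Everything rests
   on the completeness of H^1 (Riesz-Fischer) and on the uniqueness of weak
   derivatives (approximation of indicators of boxes by smooth bumps). *)

Set Implicit Arguments.
Unset Strict Implicit.
Unset Printing Implicit Defensive.

Import Order.TTheory GRing.Theory Num.Theory.
Import numFieldNormedType.Exports.

Local Open Scope classical_set_scope.
Local Open Scope ring_scope.

(** * Riesz representation in complete semi-inner product spaces *)

(** Fields are total functions that count only up to equality almost everywhere, and no quotient is
    formed. Representation is therefore proved for a form that may vanish on nonzero elements and is
    linear only on a subset [M], since integrals add only for integrable functions. As [wgrad] is a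
    choice, it is linear only almost everywhere; completeness and representation are set in the
    space of pairs (function, weak gradient), where the linear structure is exact. An element of [Q]
    is any function almost everywhere equal to a sum, measurable or not, so integrals must be
    invariant under such changes without measurability. Uniformity in K comes from the weight K on
    the gradient term of the Riesz problem: for v = - K grad y the quantity K^-1 |v|^2 equals K
    |grad y|^2, which is exactly the second term in the energy of the decomposition q = (q - y) + y.
    The supremum in (iv) ranges over fields that are not almost everywhere zero, so when q has norm
    0 a nonzero field of V has to be supplied by other means. *)

Record semi_inner (R : realType) (E : lmodType R) (M : set E) (B : E -> E -> R) : Prop := {
  semi_inner0 : M 0;
  semi_innerZD : forall a x y, M x -> M y -> M (a *: x + y);
  semi_innerC : forall x y, B x y = B y x;
  semi_inner_linear : forall a x y z, M x -> M y -> M z ->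
    B (a *: x + y) z = a * B x z + B y z;
  semi_inner_ge0 : forall x, M x -> 0 <= B x x }.

Section semi_inner.
Context (R : realType) (E : lmodType R) (M : set E) (B : E -> E -> R).
Hypothesis HB : semi_inner M B.

Lemma semi_innerZ a x y : M x -> M y -> B (a *: x) y = a * B x y.
Proof.
move=> Mx My; have M0 := semi_inner0 HB.
have B0 : B 0 y = 0.
  by have := semi_inner_linear HB 1 M0 M0 My; rewrite scaler0 addr0 mul1r; lra.
by rewrite -[a *: x]addr0 (semi_inner_linear HB)// B0 addr0.
Qed.

Lemma semi_innerBl x y z : M x -> M y -> M z -> B (x - y) z = B x z - B y z.
Proof. by move=> *; rewrite addrC -scaleN1r (semi_inner_linear HB)//; ring. Qed.

Lemma semi_inner_stableZ a x : M x -> M (a *: x).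
Proof.
by move=> Mx; rewrite -[_ *: _]addr0; apply: (semi_innerZD HB) => //; exact: semi_inner0 HB.
Qed.

Lemma semi_inner_stableB x y : M x -> M y -> M (x - y).
Proof. by move=> Mx My; rewrite addrC -scaleN1r; exact: (semi_innerZD HB). Qed.

Lemma semi_inner_sqr a x y : M x -> M y ->
  B (a *: x + y) (a *: x + y) = a ^+ 2 * B x x + 2 * a * B x y + B y y.
Proof.
move=> Mx My; have Mxy := semi_innerZD HB a Mx My.
rewrite (semi_inner_linear HB)// ![B _ (_ + _)](semi_innerC HB).
rewrite !(semi_inner_linear HB)// [B y x](semi_innerC HB); ring.
Qed.

Lemma semi_inner_CauchySchwarz x y : M x -> M y -> B x y ^+ 2 <= B x x * B y y.
Proof.
move=> Mx My.
have Bx := semi_inner_ge0 HB Mx; have By := semi_inner_ge0 HB My.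
have H a : 0 <= a ^+ 2 * B x x + 2 * a * B x y + B y y.
  by rewrite -semi_inner_sqr//; apply: (semi_inner_ge0 HB); exact: (semi_innerZD HB).
have [Bx0|Bx0] := eqVneq (B x x) 0.
  rewrite Bx0 mul0r.
  have [->|n0] := eqVneq (B x y) 0; first by rewrite expr0n.
  (* With [B x x = 0] the quadratic in [a] is affine, and this [a] gives it the value -1. *)
  have := H (- (B y y + 1) / (2 * B x y)).
  rewrite Bx0 mulr0 add0r (_ : 2 * _ * _ = - (B y y + 1)); last by field.
  lra.
have Bxp : 0 < B x x by rewrite lt_def Bx0.
(* The minimizer of the quadratic; the product with [B x x] clears the denominator. *)
have := mulr_ge0 Bx (H (- B x y / B x x)).
set p := (X in 0 <= X); have -> : p = B x x * B y y - B x y ^+ 2 by rewrite /p; field.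
lra.
Qed.

Definition semi_inner_complete := forall u : nat -> E, (forall k, M (u k)) ->
  (forall e : R, 0 < e -> exists N, forall j k, (N <= j)%N -> (N <= k)%N ->
     B (u j - u k) (u j - u k) < e) ->
  exists2 x, M x & forall e : R, 0 < e -> exists N, forall k, (N <= k)%N ->
     B (u k - x) (u k - x) < e.

(* The representative minimizes [B x x - 2 * l x]; minimizing sequences are
   Cauchy by the parallelogram identity. *)
Lemma riesz (l : E -> R) (c : R) : semi_inner_complete ->
  (forall a x y, M x -> M y -> l (a *: x + y) = a * l x + l y) ->
  (forall x, M x -> l x ^+ 2 <= c * B x x) ->
  exists2 x, M x & forall y, M y -> B x y = l y.
Proof.
move=> complete llin lb.
have M0 := semi_inner0 HB.
have l0 : l 0 = 0.
  by have := llin 1 0 0 M0 M0; rewrite scaler0 addr0 mul1r; lra.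
have MB := semi_inner_stableB.
pose J x := B x x - 2 * l x.
have JE a x y : M x -> M y ->
    J (a *: x + y) = a ^+ 2 * B x x + 2 * a * (B x y - l x) + J y.
  by move=> Mx My; rewrite /J semi_inner_sqr// llin//; ring.
(* From t^2 <= C b follows 2 t <= 2 sqrt (C b) <= b + C, argued through squares to avoid roots. The
   absolute value is there because [c] has no assumed sign. *)
have Jlb x : M x -> - `|c| <= J x.
  move=> Mx; have := lb _ Mx; have := semi_inner_ge0 HB Mx.
  have := ler_norm c; have := normr_ge0 c; rewrite /J.
  move: (B x x) (l x) `|c| => b t C C0 cC b0 tb.
  have {}tb : t ^+ 2 <= C * b by apply: (le_trans tb); exact: ler_wpM2r.
  case: (lerP (2 * t) (b + C)) => [|h]; first lra.
  have : (b + C) ^+ 2 < (2 * t) ^+ 2 by rewrite ltr_pXn2r ?nnegrE//; lra.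
  have := sqr_ge0 (b - C); nra.
pose S := [set J x | x in M].
have S0 : S !=set0 by exists (J 0), 0.
have lbS : has_lbound S by exists (- `|c|) => _ [x Mx <-]; exact: Jlb.
have infJ x : M x -> inf S <= J x by move=> Mx; apply: ge_inf => //; exists x.
have ex k : exists x, M x /\ J x < inf S + k.+1%:R^-1.
  have [|_ [x Mx <-] Jx] := @inf_adherent _ S k.+1%:R^-1 _ (conj S0 lbS).
    by rewrite invr_gt0.
  by exists x.
have [u uE] := choice ex.
have Mu k : M (u k) by have [] := uE k.
have Ju k : J (u k) < inf S + k.+1%:R^-1 by have [] := uE k.
have small (e : R) : 0 < e -> exists N, forall k, (N <= k)%N -> k.+1%:R^-1 < e.
  move=> e0; exists (Num.truncn e^-1) => k Nk.
  rewrite -[e]invrK ltf_pV2 ?posrE ?invr_gt0 ?ltr0n//.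
  by apply: (lt_le_trans (truncnS_gt _)); rewrite ler_nat.
have cauchy (e : R) : 0 < e -> exists N, forall j k, (N <= j)%N -> (N <= k)%N ->
    B (u j - u k) (u j - u k) < e.
  move=> e0; have [|N NE] := small (e / 4); first by rewrite divr_gt0.
  exists N => j k Nj Nk.
  (* The midpoint of [u j] and [u k]: J(u j) + J(u k) - 2 J(midpoint) is half of the squared
     distance, so the distance squared is below 2 (e/4 + e/4) = e. *)
  have := infJ (2^-1 *: (u j - u k) + u k).
  rewrite JE//; last exact: MB.
  move/(_ (semi_innerZD HB _ (MB _ _ (Mu j) (Mu k)) (Mu k))).
  have := JE 1 (u j - u k) (u k) (MB _ _ (Mu j) (Mu k)) (Mu k).
  rewrite scale1r subrK.
  have := Ju j; have := Ju k; have := NE _ Nj; have := NE _ Nk.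
  move: (k.+1%:R^-1) (j.+1%:R^-1) (B (u j - u k) (u j - u k)) (B (u j - u k) (u k) - l (u j - u k)) (J (u k)) (J (u j)) (inf S) => hk hj b t Jk Jj i. rewrite expr1n exprVn. lra.
have [x Mx ux] := complete u Mu cauchy.
exists x => // y My.
apply/eqP; rewrite -subr_eq0 -sqrf_eq0; apply/eqP/le_anti; rewrite sqr_ge0 andbT.
apply/ler_addgt0Pl => e e0; rewrite addr0.
have By := semi_inner_ge0 HB My.
(* The defect [B x y - l y] splits into two parts whose squares are at most e' ([B y y] + 1); (s -
   t)^2 <= 2 s^2 + 2 t^2 then yields e. The + 1 avoids dividing by zero when [B y y = 0]. *)
have e'0 : 0 < e / (4 * (B y y + 1)) by rewrite divr_gt0// mulr_gt0//; lra.
have [N1 N1E] := small _ e'0; have [N2 N2E] := ux _ e'0.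
pose k := maxn N1 N2.
have {N1E} := N1E k (leq_maxl _ _); have {N2E} := N2E k (leq_maxr _ _).
(* Approximate Euler equation: moving from [u k] along [y] lowers J by at most 1/(k+1), which bounds
   the derivative of J in that direction. The step [t] is the optimal one, again regularized by +
   1. *)
have d2 : (B (u k) y - l y) ^+ 2 <= k.+1%:R^-1 * (B y y + 1).
  pose t := - (B (u k) y - l y) / (B y y + 1).
  have := infJ _ (semi_innerZD HB t My (Mu k)); rewrite JE// [B y (u k)](semi_innerC HB).
  have := Ju k; rewrite /t; move: (k.+1%:R^-1) (B (u k) y - l y) (J (u k)) (inf S) => h d j i.
  move=> ji H; have {ji}H : (- d / (B y y + 1)) ^+ 2 * B y y +
      2 * (- d / (B y y + 1)) * d + h >= 0 by lra.
  have b1 : 0 < B y y + 1 by lra.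
  have: 0 <= (B y y + 1) ^+ 2 * ((- d / (B y y + 1)) ^+ 2 * B y y +
      2 * (- d / (B y y + 1)) * d + h) by rewrite mulr_ge0// sqr_ge0.
  set p := (X in 0 <= X); have -> : p = - d ^+ 2 * (B y y + 2) + h * (B y y + 1) ^+ 2.
    by rewrite /p; field; lra.
  move=> {}H; rewrite -(ler_pM2r b1); nra.
have cs := semi_inner_CauchySchwarz (MB _ _ (Mu k) Mx) My.
have E1 : B (u k - x) y = B (u k) y - B x y by exact: semi_innerBl.
rewrite E1 in cs.
have Bu := semi_inner_ge0 HB (MB _ _ (Mu k) Mx).
move: (B (u k - x) _) (k.+1%:R^-1) d2 cs Bu => p h d2 cs p0 pe he.
have b1 : 0 < 4 * (B y y + 1) by lra.
rewrite ltr_pdivlMr// in pe; rewrite ltr_pdivlMr// in he.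
have := sqr_ge0 ((B (u k) y - l y) + (B (u k) y - B x y)).
nra.
Qed.

End semi_inner.

(** * Square-integrable functions *)

Section square_integrable.
Context d (T : measurableType d) (R : realType) (mu : {measure set T -> \bar R}).
Variables (D : set T) (mD : measurable D).
Implicit Types f g h : T -> R.

(** Measurability of [f] is a separate clause because it does not follow from that of its square. *)
Definition sq_integrable f :=
  measurable_fun D f /\ mu.-integrable D (fun x => (f x ^+ 2)%:E).

Definition ip f g : R := \int[mu]_(x in D) (f x * g x).

Lemma sq_integrableM f g : sq_integrable f -> sq_integrable g ->
  mu.-integrable D (EFin \o (fun x => f x * g x)).
Proof.
move=> [mf f2] [mg g2].
apply: (@le_integrable _ _ _ _ _ mD _ ((fun x => (f x ^+ 2)%:E) \+ (fun x => (g x ^+ 2)%:E))%E).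
- by apply/measurable_EFinP; exact: measurable_funM.
- move=> x Dx /=; rewrite lee_fin normrM.
  have := sqr_ge0 (`|f x| - `|g x|).
  rewrite -(real_normK (num_real (f x))) -(real_normK (num_real (g x))).
  have := normr_ge0 (f x); have := normr_ge0 (g x).
  move: `|f x| `|g x| => a b b0 a0 H; rewrite ger0_norm; last nra.
  nra.
- exact: integrableD.
Qed.

Lemma sq_integrable0 : sq_integrable (fun=> 0).
Proof.
split=> //.
by rewrite (_ : (fun _ => _) = cst 0%E) ?integrable0//; apply/funext => x; rewrite expr0n.
Qed.

Lemma sq_integrableZD a f g : sq_integrable f -> sq_integrable g ->
  sq_integrable (fun x => a * f x + g x).
Proof.
move=> sf sg; have [mf f2] := sf; have [mg g2] := sg.
have m : measurable_fun D (fun x => a * f x + g x).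
  by apply: measurable_funD => //; exact: measurable_funM.
split=> //.
apply: (@eq_integrable _ _ _ mu D mD (((fun x => (a ^+ 2)%:E * (f x ^+ 2)%:E) \+
   ((fun x => (2 * a)%:E * (f x * g x)%:E) \+ (fun x => (g x ^+ 2)%:E)))%E)).
  by move=> x _ /=; rewrite -!EFinM -!EFinD; congr EFin; ring.
apply: integrableD => //; first exact: integrableZl.
by apply: integrableD => //; apply: integrableZl => //; exact: sq_integrableM.
Qed.

Lemma ipC f g : ip f g = ip g f.
Proof. by apply: eq_Rintegral => x _; rewrite mulrC. Qed.

Lemma ip_ge0 f : 0 <= ip f f.
Proof. by apply: Rintegral_ge0 => x _; rewrite -expr2 sqr_ge0. Qed.

Lemma ipZD a f g h : sq_integrable f -> sq_integrable g -> sq_integrable h ->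
  ip (fun x => a * f x + g x) h = a * ip f h + ip g h.
Proof.
move=> sf sg sh; rewrite /ip -RintegralZl//; last exact: sq_integrableM.
rewrite -RintegralD//.
- by apply: eq_Rintegral => x _; ring.
- by apply: (integrableZl _ a (f:=fun x => (f x * h x)%:E)) => //; exact: sq_integrableM.
- exact: sq_integrableM.
Qed.

(** Measurability of [g] is assumed since [mu] need not be complete: a change on a null set can
    destroy it. *)
Lemma sq_integrable_ae f g : measurable_fun D g -> sq_integrable f ->
  ae_eq mu D f g -> sq_integrable g.
Proof.
move=> mg [mf f2] fg; split=> //.
move/integrableP: f2 => [mf2 f2]; apply/integrableP; split.
  by apply/measurable_EFinP; exact: measurable_funX.
rewrite (_ : (\int[mu]_(x in D) _)%E = (\int[mu]_(x in D) `|(f x ^+ 2)%:E|)%E)//.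
apply: ae_eq_integral => //.
- by apply: measurableT_comp => //; apply/measurable_EFinP; exact: measurable_funX.
- by apply: measurableT_comp.
- by apply: filterS fg => x /[apply] ->.
Qed.

End square_integrable.

(** * Integrals under changes on null sets, without measurability *)

Section ae_invariance.
Import HBNNSimple.
Context d (T : measurableType d) (R : realType) (mu : {measure set T -> \bar R}).
Variable D : set T.

(** The integral of a nonnegative function is a supremum over simple functions below it, even if the
    function is not measurable. A simple function below [F] can be set to 0 on the exceptional null
    set: it then lies below [G] and keeps its integral. *)
Lemma ge0_le_integral_ae (F G : T -> \bar R) : (forall x, 0 <= F x)%E ->
  (forall x, 0 <= G x)%E -> {ae mu, forall x, F x <= G x}%E ->
  (\int[mu]_x F x <= \int[mu]_x G x)%E.
Proof.
move=> F0 G0 [N [mN N0 FG]]; rewrite !ge0_integralTE//.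
apply: ge_ereal_sup => _ [h /= hF <-]; apply: ereal_sup_ubound => /=.
have mNC := measurableC mN.
exists (proj_nnsfun h mNC) => [x|].
  rewrite -mrestrict /patch; case: ifPn => [/set_mem xN|_ //].
  apply: (le_trans (hF x)).
  by apply: contrapT => FGx; apply: xN; exact: FG.
rewrite -mrestrict -integral_nnsfun// -setTD -ge0_negligible_integral//.
- by rewrite integral_nnsfun// patch_setT.
- by apply/measurable_EFinP; exact: measurable_funPT.
- by move=> x _; rewrite lee_fin; exact: fun_ge0.
Qed.

Lemma ae_eq_Rintegral (f g : T -> R) : ae_eq mu D f g ->
  \int[mu]_(x in D) f x = \int[mu]_(x in D) g x.
Proof.
move=> fg; rewrite /Rintegral; congr fine.
rewrite integralE [RHS]integralE.
have le (F G : T -> \bar R) : (forall x, 0 <= F x)%E -> (forall x, 0 <= G x)%E ->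
    ae_eq mu D F G -> (\int[mu]_(x in D) F x <= \int[mu]_(x in D) G x)%E.
  move=> F0 G0 FG; rewrite integral_mkcond [leRHS]integral_mkcond.
  apply: ge0_le_integral_ae => [x|x|]; [by apply: erestrict_ge0..|].
  by apply: filterS FG => x H; rewrite /patch; case: ifPn => // /set_mem/H ->.
have fgE : ae_eq mu D (EFin \o f) (EFin \o g).
  by apply: filterS fg => x H Dx /=; rewrite H.
have /ae_eq_funeposneg[fgp fgn] := fgE.
have eq (F G : T -> \bar R) : (forall x, 0 <= F x)%E -> (forall x, 0 <= G x)%E ->
    ae_eq mu D F G -> (\int[mu]_(x in D) F x = \int[mu]_(x in D) G x)%E.
  by move=> F0 G0 FG; apply/le_anti; rewrite !le//; exact: ae_eq_sym.
by congr (_ - _)%E; apply: eq.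
Qed.

End ae_invariance.

(** * Completeness of the space of square-integrable functions *)

Section completeness.
Context d (T : measurableType d) (R : realType) (mu : {measure set T -> \bar R}).
Variables (D : set T) (mD : measurable D).
Local Notation sq_integrable := (sq_integrable mu D).
Local Notation ip := (ip mu D).

Lemma sq_integrableB (f g : T -> R) : sq_integrable f -> sq_integrable g ->
  sq_integrable (fun x => f x - g x).
Proof.
move=> sf sg; rewrite (_ : (fun _ => _) = fun x => (-1) * g x + f x).
  exact: sq_integrableZD.
by apply/funext => x; rewrite mulN1r addrC.
Qed.

(* [2^k t^2 + 2^-k >= |t|] turns the quadratic bound into absolute
   summability of the increments. *)
Lemma cvg_of_weighted_increments (u : nat -> R) :
  (\sum_(0 <= k <oo) (2 ^+ k * (u k.+1 - u k) ^+ 2)%:E < +oo)%E -> cvgn u.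
Proof.
move=> h.
have {}h : cvgn (series (fun k => 2 ^+ k * (u k.+1 - u k) ^+ 2)).
  by apply: nnseries_is_cvg h => k; rewrite mulr_ge0 ?sqr_ge0// exprn_ge0.
have g : cvgn (series (geometric 1 (2^-1 : R))).
  by apply: is_cvg_geometric_series; rewrite ger0_norm ?invr_ge0// invf_lt1// ltr1n.
have hg : cvgn (series (fun k => 2 ^+ k * (u k.+1 - u k) ^+ 2 + (2 ^+ k)^-1)).
  rewrite (_ : (fun _ => _) = (fun k => 2 ^+ k * (u k.+1 - u k) ^+ 2) + geometric 1 2^-1).
    exact: is_cvg_seriesD.
  by apply/funext => k; rewrite /= -[RHS]/(_ + _) /= mul1r exprVn.
have n : cvgn (series (fun k => `|telescope u k|)).
  apply: (series_le_cvg _ _ _ hg) => k //=.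
    by apply: addr_ge0; [apply: mulr_ge0; [exact: exprn_ge0|exact: sqr_ge0]|rewrite invr_ge0 exprn_ge0].
  rewrite /telescope /=.
  have p : 0 < 2 ^+ k :> R by rewrite exprn_gt0.
  have q := divff (lt0r_neq0 p).
  have q0 : 0 < (2 ^+ k)^-1 :> R by rewrite invr_gt0.
  rewrite -(real_normK (num_real (u k.+1 - u k))).
  move: (2 ^+ k) (_^-1) p q q0 `|_| (normr_ge0 (u k.+1 - u k)) => a b a0 ab b0 t t0.
  have := sqr_ge0 (a * t - 1); have := mulr_ge0 (ltW a0) t0.
  move=> at0 H; rewrite -(ler_pM2l a0).
  nra.
have := normed_cvg n; rewrite telescopeK => c.
rewrite (_ : u = (fun k => (u k - u 0%N) + u 0%N)); last first.
  by apply/funext => k; rewrite subrK.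
by apply: is_cvgD => //; exact: is_cvg_cst.
Qed.

Lemma sq_integrable_semi_inner : semi_inner (sq_integrable : set (T -> R)) ip.
Proof.
split.
- exact: sq_integrable0.
- by move=> a f g; exact: sq_integrableZD.
- exact: ipC.
- by move=> a f g h; exact: ipZD.
- by move=> f _; exact: ip_ge0.
Qed.

Lemma ip_fineK (f : T -> R) : sq_integrable f ->
  (\int[mu]_(x in D) (f x ^+ 2)%:E = (ip f f)%:E)%E.
Proof.
move=> [_ f2]; rewrite /ip /Rintegral fineK//.
by rewrite integrable_fin_num.
Qed.

Theorem riesz_fischer : semi_inner_complete (sq_integrable : set (T -> R)) ip.
Proof.
move=> u su cauchy.
(* Squared increments below 2^-k 2^-(k+1), multiplied by the weight 2^k, have integrals summing to
   at most 1. *)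
have e_gt0 k : 0 < (2 ^+ k)^-1 * (2 ^ k.+1)%:R^-1 :> R.
  by rewrite mulr_gt0// invr_gt0 ?exprn_gt0// ltr0n expn_gt0.
have [N NE] := choice (fun k => cauchy _ (e_gt0 k)).
(* The sum makes [n] nondecreasing with [n k] at least [N k] and at least k: both [n k] and [n k.+1]
   pass the threshold [N k], and the subsequence eventually passes any threshold. *)
pose n k := (\sum_(j < k.+1) maxn (N j) j)%N.
have lekn k : (maxn (N k) k <= n k)%N by rewrite /n big_ord_recr leq_addl.
have leNn k : (N k <= n k)%N by apply: leq_trans (lekn k); exact: leq_maxl.
have leNnS k : (N k <= n k.+1)%N.
  by apply: (leq_trans (leNn k)); rewrite /n [X in (_ <= X)%N]big_ord_recr leq_addr.
pose g k := u (n k).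
have sg k : sq_integrable (g k) by exact: su.
have gE k : ip (fun x => g k.+1 x - g k x) (fun x => g k.+1 x - g k x) <
    (2 ^+ k)^-1 * (2 ^ k.+1)%:R^-1 by exact: NE.
pose h k x := (2 ^+ k * (g k.+1 x - g k x) ^+ 2)%:E.
have h0 k x : (0 <= h k x)%E by rewrite lee_fin mulr_ge0// ?sqr_ge0// exprn_ge0.
have mh k : measurable_fun D (h k).
  apply/measurable_EFinP; apply: measurable_funM => //; apply: measurable_funX.
  by apply: measurable_funB; [case: (sg k.+1)|case: (sg k)].
have hint : (\int[mu]_(x in D) (\sum_(0 <= k <oo) h k x) < +oo)%E.
  rewrite integral_nneseries//.
  have := @cvg_geometric_eseries_half R 1 0; rewrite expr0 divr1 => /cvg_lim E.
  apply: (@le_lt_trans _ _ 1%:E); last exact: ltry.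
  rewrite -E//; apply: lee_nneseries => [k _ _|k _].
    by apply: integral_ge0 => x _.
  rewrite /h; under eq_integral do rewrite EFinM.
  have sd := sq_integrableB (sg k.+1) (sg k).
  rewrite integralZl//; last by case: sd.
  rewrite ip_fineK// -EFinM lee_fin div1r addn1 -ler_pdivlMl ?exprn_gt0//.
  exact/ltW/gE.
have [N0 [mN0 N00 N0E]] : {ae mu, forall x, D x -> (\sum_(0 <= k <oo) h k x < +oo)%E}.
  have hi : mu.-integrable D (fun x => \sum_(0 <= k <oo) h k x)%E.
    apply/integrableP; split; first exact: ge0_emeasurable_sum.
    under eq_integral do rewrite gee0_abs ?nneseries_ge0//.
    exact: hint.
  apply: filterS (integrable_ae mD hi) => x H Dx.
  by rewrite -ge0_fin_numE ?nneseries_ge0//; exact: H.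
have cvgg x : D x -> ~ N0 x -> cvgn (g ^~ x).
  move=> Dx N0x; apply: cvg_of_weighted_increments.
  by apply: contrapT => H; apply: N0x; apply: N0E => /(_ Dx).
(* Setting the subsequence to 0 on the null set of divergence makes it converge at every point of
   [D], so that its limit is measurable. *)
pose g' k := (g k) \_ (~` N0).
pose f x := lim (g' ^~ x @ \oo).
have g'f x : D x -> g' ^~ x @ \oo --> f x.
  move=> Dx; rewrite /f; have [N0x|N0x] := pselect (N0 x).
    rewrite (_ : g' ^~ x = cst 0); first by apply: is_cvg_cst.
    by apply/funext => k; rewrite /g' patchE memNset//; apply.
  rewrite (_ : g' ^~ x = g ^~ x); first exact: cvgg.
  by apply/funext => k; rewrite /g' patchE mem_set.
have mg' k : measurable_fun D (g' k).
  rewrite /g'; apply/measurable_restrict => //; first exact: measurableC.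
  by apply: measurable_funS (proj1 (sg k)) => // x [].
have mf : measurable_fun D f by exact: (measurable_fun_cvg mg').
have aeg k : ae_eq mu D (g k) (g' k).
  exists N0; split=> // x /= /not_implyP[Dx gg']; apply: contrapT => N0x; apply: gg'.
  by rewrite /g' patchE mem_set.
have sg' k : sq_integrable (g' k) by apply: (sq_integrable_ae mD _ (sg k)).
(* Fatou's lemma bounds the distance of [u j] to the pointwise limit. *)
have bound (e : R) : 0 < e -> exists M, forall j, (M <= j)%N ->
    (\int[mu]_(x in D) ((u j x - f x) ^+ 2)%:E <= e%:E)%E.
  move=> e0; have [M ME] := cauchy _ e0; exists M => j Mj.
  pose F k x := ((u j x - g' k x) ^+ 2)%:E.
  have mF k : measurable_fun D (F k).
    apply/measurable_EFinP; apply: measurable_funX.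
    by apply: measurable_funB => //; case: (su j).
  have -> : (\int[mu]_(x in D) ((u j x - f x) ^+ 2)%:E =
      \int[mu]_(x in D) limn_einf (F ^~ x))%E.
    apply: eq_integral => x /set_mem Dx.
    suff cF : F ^~ x @ \oo --> ((u j x - f x) ^+ 2)%:E by rewrite (cvg_limn_einf_sup cF).
    apply/fine_cvgP; split; first by near=> k.
    have c : (fun k => u j x - g' k x) @ \oo --> u j x - f x.
      by apply: cvgB; [exact: cvg_cst|exact: g'f].
    exact: (cvgM c c).
  have F0 k x : D x -> (0 <= F k x)%E by rewrite lee_fin sqr_ge0.
  apply: (le_trans (fatou mu mD mF F0)).
  rewrite limn_einf_lim; apply: lime_le; first exact: is_cvg_einfs.
  exists M => // k /= Mk; apply: (@le_trans _ _ (\int[mu]_(x in D) F k x)%E).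
    by apply: ereal_inf_lbound; exists k => /=.
  have sd := sq_integrableB (su j) (sg k).
  rewrite (_ : (\int[mu]_(x in D) F k x)%E = (\int[mu]_(x in D) ((u j x - g k x) ^+ 2)%:E)%E).
    rewrite ip_fineK// lee_fin; apply/ltW/ME => //.
    by apply: (leq_trans Mk); apply: leq_trans (lekn k); exact: leq_maxr.
  apply: ae_eq_integral => //.
    by apply/measurable_EFinP; apply: measurable_funX; case: sd.
  by apply: filterS (aeg k) => x H Dx; rewrite /F H.
have sf : sq_integrable f.
  have [M ME] := bound 1 ltr01.
  have sd : sq_integrable (fun x => u M x - f x).
    have m : measurable_fun D (fun x => u M x - f x).
      by apply: measurable_funB => //; case: (su M).
    split=> //; apply/integrableP; split.
      by apply/measurable_EFinP; exact: measurable_funX.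
    under eq_integral do rewrite gee0_abs ?lee_fin ?sqr_ge0//.
    by apply: (le_lt_trans (ME M (leqnn _))); exact: ltry.
  rewrite (_ : f = fun x => u M x - (u M x - f x)); first exact: sq_integrableB.
  by apply/funext => x; rewrite opprB addrC subrK.
exists f => // e e0.
(* Fatou's lemma only gives a weak inequality; halving restores the strict one. *)
have [|M ME] := bound (e / 2); first by rewrite divr_gt0.
exists M => k Mk; have := ME k Mk.
have sd := sq_integrableB (su k) sf.
rewrite ip_fineK// lee_fin => /le_lt_trans; apply.
by rewrite ltr_pdivrMr// ltr_pMr// ltr1n.
Unshelve. all: by end_near. Qed.

End completeness.

(** * Fubini and integration by parts for [leb] *)

Section lebesgue_rV.
Context (R : realType) (n : nat).

Definition cube (r : R) : set 'rV[R]_n := [set x | forall i, `[- r, r]%classic (x ord0 i)].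

Lemma measurable_cube r : measurable (cube r).
Proof. by apply: (measurable_box (A:=fun=> `[- r, r]%classic)) => i; exact: measurable_itv. Qed.

Lemma leb_cube_lty r : (leb R n (cube r) < +oo)%E.
Proof.
rewrite (leb_box (A:=fun=> `[- r, r]%classic)) => [|i]; last exact: measurable_itv.
rewrite ltey_eq; apply/orP; left; elim/big_ind : _ => //; first exact: fin_numM.
by move=> i _; rewrite lebesgue_measure_itv /=; case: ifP.
Qed.

Lemma sigma_finite_leb : sigma_finite setT (leb R n).
Proof.
exists (fun k => cube k%:R).
  apply/seteqP; split=> // x _.
  pose m := \sum_(i < n) `|x ord0 i|.
  exists (Num.truncn m).+1 => // i; rewrite /= in_itv/= -ler_norml.
  apply: (@le_trans _ _ m); last exact/ltW/truncnS_gt.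
  by rewrite /m (bigD1 i)//= lerDl sumr_ge0.
by move=> k; split; [exact: measurable_cube|exact: leb_cube_lty].
Qed.

(* A copy of [leb R n] on which sigma-finiteness can be declared as an instance. *)
Definition leb_fun : set 'rV[R]_n -> \bar R := leb R n.
HB.instance Definition _ := Measure.copy leb_fun (leb R n).
HB.instance Definition _ := @Measure_isSigmaFinite.Build _ _ _ leb_fun sigma_finite_leb.
End lebesgue_rV.

Section lebesgue_Fubini.
Context (R : realType) (n : nat).
Local Notation lambda := (@lebesgue_measure R).
Variable f : 'rV[R]_n.+1 -> \bar R.
Hypothesis fi : (leb R n.+1).-integrable setT f.
Local Open Scope ereal_scope.

Let mf : measurable_fun setT f. Proof. by case/integrableP : fi. Qed.

Let mcons := @measurable_rV_cons R n.

Let prodE A : (leb R n \x lambda) A = (@leb_fun R n \x lambda) A.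
Proof. by rewrite /product_measure1; apply: eq_measure_integral. Qed.

Let integral_lebS (h : 'rV[R]_n.+1 -> \bar R) :
  \int[leb R n.+1]_x h x = \int[pushforward (@leb_fun R n \x lambda) (@rV_cons R n)]_x h x.
Proof. by apply: eq_measure_integral => A mA _; rewrite /= /leb_step /pushforward prodE. Qed.

Let fi_prod : (@leb_fun R n \x lambda).-integrable setT (f \o @rV_cons R n).
Proof.
case/integrableP : fi => _ foo; apply/integrableP; split.
  exact: measurableT_comp.
move: foo; rewrite integral_lebS ge0_integral_pushforward//.
exact: measurableT_comp.
Qed.

Let integral_leb_prod : \int[leb R n.+1]_x f x =
  \int[(@leb_fun R n \x lambda)]_p f (rV_cons p).
Proof. by rewrite integral_lebS integral_pushforward. Qed.

Lemma leb_Fubini1 : \int[leb R n.+1]_x f x =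
  \int[leb R n]_v \int[lambda]_t f (rV_cons (v, t)).
Proof.
rewrite integral_leb_prod -(integral12_prod_meas1 fi_prod) /fubini_F.
by apply: eq_measure_integral.
Qed.

Lemma leb_Fubini2 : \int[leb R n.+1]_x f x =
  \int[lambda]_t \int[leb R n]_v f (rV_cons (v, t)).
Proof.
rewrite integral_leb_prod -(integral21_prod_meas1 fi_prod) /fubini_G.
by apply: eq_integral => t _; apply: eq_measure_integral.
Qed.

End lebesgue_Fubini.

(** * Vanishing integrals of compactly supported derivatives *)

Section compact_support_integrals.
Context (R : realType).

Lemma compact_cube n r : compact (cube r : set 'rV[R]_n).
Proof.
by apply: (@rV_compact R n (fun=> `[- r, r]%classic)) => i; exact: segment_compact.
Qed.

Lemma continuous_cube_bounded n (g : 'rV[R]_n -> R) (r : R) : continuous g ->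
  [bounded g x | x in cube r].
Proof.
move=> cg.
have /compact_bounded : compact (g @` cube r).
  by apply: continuous_compact; [exact: continuous_subspaceT|exact: compact_cube].
by move=> [M [Mr H]]; exists M; split=> // y /H h x cx; apply: h; exists x.
Qed.

Lemma continuous_cube_integrable n (g : 'rV[R]_n -> R) (r : R) : continuous g ->
  (forall x, ~ cube r x -> g x = 0) -> (leb R n).-integrable setT (EFin \o g).
Proof.
move=> cg g0.
rewrite (_ : EFin \o g = (EFin \o g) \_ (cube r)).
  rewrite -integrable_mkcond; last exact: measurable_cube.
  apply: measurable_bounded_integrable.
  - exact: measurable_cube.
  - exact: leb_cube_lty.
  - by apply: measurable_funTS; exact: continuous_measurable_rV.
  - exact: continuous_cube_bounded.
apply/funext => x; rewrite patchE; case: ifPn => // /negP cx /=.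
by rewrite g0// => /mem_set.
Qed.

Lemma integral_is_derive0 (f g : R -> R) (r : R) : (forall t : R, is_derive t (1 : R) f (g t)) ->
  continuous g -> (forall t, r < `|t| -> f t = 0 /\ g t = 0) ->
  (\int[@lebesgue_measure R]_t (g t)%:E = 0)%E.
Proof.
move=> fg cg supp.
(* The hypothesis says nothing at |t| = r, and [r] may be negative; [s] is positive and lies
   strictly beyond [r], so [f] vanishes at both endpoints. *)
pose s := `|r| + 1.
have s0 : 0 < s by rewrite /s ltr_wpDl.
have rs : r < s by rewrite /s (le_lt_trans (ler_norm r))// ltrDl.
have cf : continuous f.
  move=> t; apply: differentiable_continuous; apply/derivable1_diffP.
  by have [] := fg t.
rewrite (_ : (fun t => _) = ((fun t => (g t)%:E) \_ `[- s, s])); last first.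
  apply/funext => t; rewrite patchE; case: ifPn => // /negP ts.
  rewrite (proj2 (supp t _))// (lt_trans rs)// ltNge; apply/negP => ts'; apply: ts.
  by rewrite inE /= in_itv /= -ler_norml.
rewrite -integral_mkcond (continuous_FTC2 (F:=f)).
- rewrite (proj1 (supp s _)) ?(proj1 (supp (- s) _)) ?subee//.
    by rewrite normrN gtr0_norm.
  by rewrite gtr0_norm.
- by rewrite gtrN.
- exact: continuous_subspaceT.
- split.
  + by move=> t _; have [] := fg t.
  + by apply: cvg_at_right_filter; exact: cf.
  + by apply: cvg_at_left_filter; exact: cf.
- by move=> t _; rewrite derive1E; have [_] := fg t.
Qed.

(** Along an affine [c] the two difference quotients are the same function of h. It is used for
    slices of a function of several variables and for functions of one coordinate. *)
Lemma is_derive_line (V W : normedModType R) (f : W -> R) (c : V -> W) w v t l :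
  (forall h : R, c (h *: w + t) = h *: v + c t) ->
  is_derive (c t) v f l -> is_derive t w (f \o c) l.
Proof.
move=> cE [df dl].
have E : (fun h : R => h^-1 *: ((f \o c) (h *: w + t) - (f \o c) t)) =
    (fun h => h^-1 *: (f (h *: v + c t) - f (c t))).
  by apply/funext => h /=; rewrite cE.
split; first by rewrite /derivable /= E.
by rewrite /derive /= E.
Qed.

Lemma rV_consP n (p : 'rV[R]_n * measurableTypeR R) (x : 'rV[R]_n.+1) :
  x ord0 ord0 = p.2 -> (forall j : 'I_n, x ord0 (lift ord0 j) = p.1 ord0 j) -> rV_cons p = x.
Proof.
move=> x0 xS; apply/rowP => i; case: (unliftP ord0 i) => [j|] ->.
  by rewrite xS (_ : lift ord0 j = rshift 1 j) ?rV_consS//; exact: val_inj.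
by rewrite x0 rV_cons0.
Qed.

Lemma rV_cons_lift n (p : 'rV[R]_n * measurableTypeR R) i (j : 'I_n) :
  rV_cons p i (lift ord0 j) = p.1 i j.
Proof. by rewrite (_ : lift ord0 j = rshift 1 j) ?rV_consS//; exact: val_inj. Qed.

Lemma ball_rV_cons n (v w : 'rV[R]_n) (s t : R) e : ball v e w -> ball s e t ->
  ball (rV_cons (v, s)) e (rV_cons (w, t)).
Proof.
move=> [e0 vw] st; split=> // i j; case: (unliftP ord0 j) => [k|] ->.
  by rewrite !rV_cons_lift; exact: vw.
by rewrite !rV_cons0.
Qed.

(** Induction on the dimension. The order of integration is chosen so that the inner integral
    already vanishes: over the first coordinate, by the fundamental theorem of calculus, if this is
    the direction of differentiation, and otherwise over the remaining coordinates, by induction. *)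
Theorem integral_partial0 n (i : 'I_n) (f g : 'rV[R]_n -> R) (r : R) :
  continuous f -> continuous g -> (forall x, is_derive x 'e_i f (g x)) ->
  (forall x, ~ cube r x -> f x = 0 /\ g x = 0) ->
  (\int[leb R n]_x (g x)%:E = 0)%E.
Proof.
elim: n i f g => [[]//|n IH i f g cf cg fg supp].
have gi : (leb R n.+1).-integrable setT (EFin \o g).
  by apply: (continuous_cube_integrable (r:=r)) => // x /supp[].
have cc1 (v : 'rV[R]_n) : continuous (fun t : R => rV_cons (v, t)).
  move=> s B /nbhs_ballP[e e0 eB]; apply/nbhs_ballP; exists e => // t st.
  exact/eB/(ball_rV_cons (ballxx _ e0) st).
have cc2 (t : R) : continuous (fun v : 'rV[R]_n => rV_cons (v, t)).
  move=> v B /nbhs_ballP[e e0 eB]; apply/nbhs_ballP; exists e => // w vw.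
  exact/eB/(ball_rV_cons vw (ballxx _ e0)).
have Nc1 (v : 'rV[R]_n) (t : R) : r < `|t| -> ~ cube r (rV_cons (v, t)).
  by move=> rt /(_ ord0); rewrite rV_cons0 /= in_itv/= -ler_norml leNgt rt.
have Nc2 (v : 'rV[R]_n) (t : R) : ~ cube r v -> ~ cube r (rV_cons (v, t)).
  by apply: contra_not => H j; have := H (lift ord0 j); rewrite rV_cons_lift.
case: (unliftP ord0 i) => [j ij|i0].
- rewrite (leb_Fubini2 gi); apply: integral0_eq => /= t _.
  apply: (IH j (fun v => f (rV_cons (v, t)))).
  + by move=> v; apply: continuous_comp; [exact: cc2|exact: cf].
  + by move=> v; apply: continuous_comp; [exact: cc2|exact: cg].
  + move=> v; apply: (is_derive_line (c:=fun w => rV_cons (w, t)) (v:='e_i)) => // h.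
    apply: rV_consP => [|k]; rewrite mxE.
      by rewrite rV_cons0 !mxE ij mulr0 add0r.
    by rewrite rV_cons_lift !mxE ij (inj_eq lift_inj).
  + by move=> v /(Nc2 v t)/supp.
- rewrite (leb_Fubini1 gi); apply: integral0_eq => v _.
  apply: (integral_is_derive0 (f:=fun t => f (rV_cons (v, t))) (r:=r)).
  + move=> t; apply: (is_derive_line (c:=fun t => rV_cons (v, t)) (v:='e_i)) => // h.
    apply: rV_consP => [|k]; rewrite mxE.
      by rewrite rV_cons0 !mxE i0 eqxx scaler1 mulr1.
    by rewrite rV_cons_lift !mxE i0 mulr0 add0r.
  + by move=> t; apply: continuous_comp; [exact: cc1|exact: cg].
  + by move=> t /(Nc1 v)/supp.
Qed.

End compact_support_integrals.

(** * Smooth bump functions on boxes *)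

Section flat_function.
Context (R : realType).
Implicit Types (p : {poly R}) (t : R).

(** The classical function exp(-1/t), flat at 0, with a polynomial factor in 1/t: this makes the
    family closed under differentiation, the derivative of p(1/t) exp(-1/t) being t^-2 (p - p')(1/t)
    exp(-1/t). *)
Definition flat p t : R := if 0 < t then p.[t^-1] * expR (- t^-1) else 0.

(** exp(s) is the power m + 1 of exp(s/(m+1)), which is at least 1 + s/(m+1). *)
Lemma expR_ge_pow (s : R) m : 0 <= s -> (s / m.+1%:R) ^+ m.+1 <= expR s.
Proof.
move=> s0.
have {2}-> : s = m.+1%:R * (s / m.+1%:R) by rewrite mulrC divfK.
rewrite expRM_natl lerXn2r ?nnegrE ?expR_ge0 ?divr_ge0//.
by apply: le_trans (expR_ge1Dx _); rewrite lerDr.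
Qed.

(** For s = 1/t >= 1 the polynomial is at most P s^m, with m = [size p], while the exponential
    absorbs s^(m+1); one factor t is left over. *)
Lemma flat_le p : exists2 C : R, 0 <= C & forall t, 0 < t -> t <= 1 -> `|flat p t| <= C * t.
Proof.
pose m := size p; pose P := \sum_(i < m) `|p`_i|.
exists (P * m.+1%:R ^+ m.+1); first by rewrite mulr_ge0 ?exprn_ge0// sumr_ge0.
move=> t t0 t1; rewrite /flat t0.
set s := t^-1; have s1 : 1 <= s by rewrite invf_ge1.
have s0 : 0 < s by rewrite (lt_le_trans ltr01).
have -> : t = s^-1 by rewrite invrK.
have ps : `|p.[s]| <= P * s ^+ m.
  rewrite horner_coef (le_trans (ler_norm_sum _ _ _))// mulr_suml ler_sum// => i _.
  rewrite normrM ler_wpM2l// normrX gtr0_norm// ler_weXn2l//.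
  exact/ltnW/ltn_ord.
rewrite normrM (ger0_norm (expR_ge0 _)) expRN.
rewrite ler_pdivrMr ?expR_gt0//.
apply: (le_trans ps).
have P0 : 0 <= P by rewrite sumr_ge0.
have := ler_wpM2l P0 (expR_ge_pow m (ltW s0)).
rewrite expr_div_n => H.
have K0 : 0 < m.+1%:R ^+ m.+1 / s by rewrite divr_gt0// exprn_gt0.
move/(ler_wpM2l (ltW K0)) : H => /=.
rewrite (_ : _ / s * (P * _) = P * s ^+ m); last first.
  rewrite [s ^+ m.+1]exprS; field.
  by rewrite expf_neq0 ?lt0r_neq0// pnatr_eq0.
move/le_trans; apply.
by rewrite le_eqVlt; apply/orP; left; apply/eqP; ring.
Qed.

Lemma is_derive_flat p t : is_derive t (1 : R) (flat p) (flat ('X ^+ 2 * (p - p^`())) t).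
Proof.
have [t0|t0|t0] := ltgtP t 0.
- rewrite /flat [X in is_derive _ _ _ X]ifF; last by rewrite ltNge ltW.
  apply: (@near_eq_is_derive _ _ _ (cst 0)) => //.
  near=> x; rewrite ifF//; apply/negbTE; rewrite -leNgt ltW//.
  by near: x; exact: lt_nbhsl.
- rewrite [X in is_derive _ _ _ X]/flat t0.
  apply: (@near_eq_is_derive _ _ _ ((horner p \o GRing.inv) * (expR \o (- GRing.inv : R -> R)))).
    near=> x; rewrite /flat ifT//.
    by near: x; exact: lt_nbhsr.
  have iV : is_derive t (1 : R) (GRing.inv : R -> R) (- t ^- 2).
    have := @is_deriveV R id t 1 1 (lt0r_neq0 t0) _.
    by rewrite /= -[_ *: 1]/(_ * 1) mulr1; apply.
  have ip := @is_derive1_comp _ _ _ _ _ _ (is_derive_poly p t^-1) iV.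
  have iN := is_deriveN iV.
  have ie := @is_derive1_comp R expR (- (GRing.inv : R -> R)) t _ _ (is_derive_expR _) iN.
  apply: is_derive_eq (is_deriveM ip ie) _.
  rewrite -[LHS]/(_ * _ + _ * _) !hornerE /= !exprVn; ring.
- subst t; rewrite [X in is_derive _ _ _ X]/flat ltxx.
  (* The difference quotient of [flat p] at 0 is [flat ('X * p)] for h > 0 and 0 for h < 0, so the
     linear bound forces the limit 0. *)
  have [C C0 CE] := flat_le ('X * p).
  have H : (fun h : R => h^-1 *: (flat p (h *: (1:R) + 0) - flat p 0)) @ 0^' --> (0 : R).
    apply/cvgr0Pnorm_lt => e e0.
    pose d := Num.min 1 (e / (C + 1)).
    have d0 : 0 < d by rewrite lt_min ltr01 divr_gt0//; lra.
    near=> h.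
    have h0 : h != 0 by near: h; exact: nbhs_dnbhs_neq.
    rewrite [flat p 0]/flat ltxx subr0 addr0 -[h *: 1]/(h * 1) mulr1.
    have [hp|hn] := ltP 0 h; last first.
      by rewrite /flat ifF ?scaler0 ?normr0//; apply/negbTE; rewrite -leNgt.
    rewrite (_ : _ *: _ = flat ('X * p) h); last first.
      by rewrite /flat hp !hornerE -[LHS]/(_ * _) mulrA.
    have h1 : h <= 1 /\ (C + 1) * h < e.
      have : `|h| < d by near: h; exact: dnbhs0_lt.
      rewrite gtr0_norm// lt_min => /andP[/ltW h1]; rewrite ltr_pdivlMr; last lra.
      by rewrite mulrC.
    by apply: (le_lt_trans (CE _ hp (proj1 h1))); nra.
  split; first by apply/cvg_ex; exists 0.
  by rewrite /derive; apply/cvg_lim.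
Unshelve. all: by end_near.
Qed.

Lemma continuous_flat p : continuous (flat p).
Proof.
move=> t; apply: differentiable_continuous; apply/derivable1_diffP.
by have [] := is_derive_flat p t.
Qed.

End flat_function.

Section flat_algebra.
Context (R : realType) (n : nat).
Local Notation sfield := ('rV[R]_n -> R).

(** A class closed under all partial derivatives and made of continuous functions: smoothness then
    follows by induction on the list of directions, with no formula for higher derivatives. *)
Inductive flat_algebra : sfield -> Prop :=
| flat_algebra_cst c : flat_algebra (cst c)
| flat_algebra_flat p c d i : flat_algebra (fun x => flat p (c * x ord0 i + d))
| flat_algebraD f g : flat_algebra f -> flat_algebra g -> flat_algebra (f \+ g)
| flat_algebraM f g : flat_algebra f -> flat_algebra g -> flat_algebra (f \* g).

Lemma is_derive_dir (F : R -> R) (t v l : R) : is_derive t (1 : R) F l ->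
  is_derive t v F (v * l).
Proof.
move=> [dF <-]; have /derivable1_diffP dF' := dF.
split; first exact: diff_derivable.
by rewrite !deriveE// -{1}[v]mulr1 -[v * 1]/(v *: (1:R)) linearZ.
Qed.

Lemma flat_algebra_derive f (j : 'I_n) : flat_algebra f ->
  exists2 g, flat_algebra g & forall x, is_derive x 'e_j f (g x).
Proof.
elim=> {f} [c|p c d i|f g _ [f' hf' ff'] _ [g' hg' gg']|f g hf [f' hf' ff'] hg [g' hg' gg']].
- by exists (cst (0 : R)); [exact: flat_algebra_cst|move=> x; exact: is_derive_cst].
- exists (cst (c * (i == j)%:R) \* (fun x => flat ('X ^+ 2 * (p - p^`())) (c * x ord0 i + d))).
    by apply: flat_algebraM; [exact: flat_algebra_cst|exact: flat_algebra_flat].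
  move=> x; apply: (is_derive_line (c:=fun x : 'rV[R]_n => c * x ord0 i + d)
      (v:=c * (i == j)%:R)); last exact/is_derive_dir/is_derive_flat.
  by move=> h; rewrite !mxE /= -[_ *: _]/(_ * _); ring.
- exists (f' \+ g'); first exact: flat_algebraD.
  by move=> x; exact: is_deriveD.
- exists ((f \* g') \+ (g \* f')); first by apply: flat_algebraD; exact: flat_algebraM.
  by move=> x; exact: is_deriveM.
Qed.

Lemma flat_algebra_continuous f : flat_algebra f -> continuous f.
Proof.
elim=> {f} [c|p c d i|f g _ cf _ cg|f g _ cf _ cg] x.
- exact: cst_continuous.
- apply: (@continuous_comp _ _ _ (fun x : 'rV[R]_n => c * x ord0 i + d) (flat p)).
    apply: (@continuousD _ _ _ (fun x : 'rV[R]_n => c * x ord0 i) (cst d)).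
      by apply: continuousM; [exact: cst_continuous|exact: coord_continuous].
    exact: cst_continuous.
  exact: continuous_flat.
- exact: (cvgD (cf x) (cg x)).
- exact: (cvgM (cf x) (cg x)).
Qed.

Lemma flat_algebra_smooth f : flat_algebra f -> smooth f.
Proof.
move=> hf0 s; suff hf : flat_algebra (foldr (@partial R n) f s).
  split; first exact: flat_algebra_continuous.
  by move=> i x; have [g _ fg] := flat_algebra_derive i hf; have [] := fg x.
elim: s => //= i s IH; have [g hg fg] := flat_algebra_derive i IH.
rewrite (_ : partial i _ = g)//; apply/funext => x.
by rewrite /partial; have [_] := fg x.
Qed.

Definition obox (a b : 'I_n -> R) : set 'rV[R]_n :=
  [set x | forall i, `]a i, b i[%classic (x ord0 i)].

(** Each factor tends to 1 inside the box as k grows. The shift by -1 makes it vanish within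
    distance 1/k of the face, so the support stays inside the open box; for k = 0 the product is 0
    unless there are no coordinates. *)
Definition box_bump (a b : 'I_n -> R) (k : nat) : sfield := fun x =>
  \prod_(i < n) (flat 1 (k%:R * (x ord0 i - a i) - 1) * flat 1 (k%:R * (b i - x ord0 i) - 1)).

Lemma flat_algebra_bump a b k : flat_algebra (box_bump a b k).
Proof.
rewrite (_ : box_bump a b k = \big[(fun f g => f \* g)/cst 1]_(i < n)
    ((fun x : 'rV[R]_n => flat 1 (k%:R * x ord0 i + (- k%:R * a i - 1))) \*
     (fun x : 'rV[R]_n => flat 1 (- k%:R * x ord0 i + (k%:R * b i - 1))))); last first.
  apply/funext => x; apply: (big_ind2 (fun (r : R) (f : sfield) => r = f x)) => //.
    by move=> _ f _ g -> ->.
  by move=> i _ /=; congr (flat _ _ * flat _ _); ring.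
elim/big_ind : _ => //; [exact: flat_algebra_cst|exact: flat_algebraM|move=> i _].
by apply: flat_algebraM; exact: flat_algebra_flat.
Qed.

End flat_algebra.

Section bump.
Context (R : realType) (n : nat).
Local Notation sfield := ('rV[R]_n -> R).
Local Notation mu := (leb R n).

Lemma flat1_ge0 (t : R) : 0 <= flat 1 t.
Proof. by rewrite /flat; case: ifP => // _; rewrite hornerE mul1r expR_ge0. Qed.

Lemma flat1_le1 (t : R) : flat 1 t <= 1.
Proof.
rewrite /flat; case: ifP => // t0; rewrite hornerE mul1r -expR0 ler_expR.
by rewrite oppr_le0 invr_ge0 ltW.
Qed.

Lemma flat1_gt0 (t : R) : (0 < flat 1 t) = (0 < t).
Proof. by rewrite /flat; case: ifP => //; rewrite ?ltxx// hornerE mul1r expR_gt0. Qed.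

Lemma flat1_le0 (t : R) : t <= 0 -> flat 1 t = 0.
Proof. by move=> t0; rewrite /flat ltNge t0. Qed.

Lemma flat1_cvg (u : R) : 0 < u -> flat 1 (k%:R * u - 1) @[k --> \oo] --> (1 : R).
Proof.
move=> u0; apply/cvgrPdist_lt => e e0; near=> k.
(* This gives t = k u - 1 > 1/e, and 1 - exp(-1/t) <= 1/t < e. *)
have ku : (1 + e^-1) / u < k%:R by near: k; exact: nbhs_infty_gtr.
rewrite ltr_pdivrMr// in ku.
set t := _ - 1; have te : e^-1 < t by rewrite /t; lra.
have t0 : 0 < t by rewrite (lt_trans _ te)// invr_gt0.
rewrite ger0_norm ?subr_ge0 ?flat1_le1// /flat t0 hornerE mul1r.
have := expR_ge1Dx (- t^-1).
have : t^-1 < e by rewrite invf_plt.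
move: (t^-1) (expR _) => a b; lra.
Unshelve. all: by end_near. Qed.

Lemma bump_ge0 (a b : 'I_n -> R) k x : 0 <= box_bump a b k x.
Proof. by apply: prodr_ge0 => i _; rewrite mulr_ge0// flat1_ge0. Qed.

Lemma bump_le1 (a b : 'I_n -> R) k x : box_bump a b k x <= 1.
Proof.
have -> : 1 = \prod_(i < n) 1 :> R by rewrite big1.
apply: ler_prod => i _; rewrite mulr_ge0 ?flat1_ge0//=.
by rewrite mulr_ile1 ?flat1_ge0 ?flat1_le1.
Qed.

Lemma bump_cvg (a b : 'I_n -> R) x : box_bump a b k x @[k --> \oo] --> (\1_(obox a b) x : R).
Proof.
have [xB|xB] := pselect (obox a b x).
  rewrite indicE mem_set//; have -> : true%:R = \prod_(i < n) 1 :> R by rewrite big1.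
  apply: cvg_big => [|i _].
    by move=> [s t]; exact: mul_continuous.
  rewrite -[X in _ --> X]mulr1.
  have /= := xB i; rewrite in_itv/= => /andP[ax xb].
  by apply: cvgM; apply: flat1_cvg; rewrite subr_gt0.
have [i xi] : exists i, ~ `]a i, b i[%classic (x ord0 i) by exact/existsNP.
rewrite indicE memNset//.
rewrite (_ : (fun k => _) = cst (0:R)); first exact: cvg_cst.
apply/funext => k; rewrite /box_bump (bigD1 i)//=.
suff -> : flat 1 (k%:R * (x ord0 i - a i) - 1) * flat 1 (k%:R * (b i - x ord0 i) - 1) = 0.
  by rewrite mul0r.
move: xi; rewrite /= in_itv/= => /negP; rewrite negb_and -!leNgt => /orP[] h.
  rewrite flat1_le0 ?mul0r//.
  have := mulr_ge0_le0 (ler0n R k) (_ : x ord0 i - a i <= 0); rewrite subr_le0 => /(_ h); lra.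
rewrite [X in _ * X]flat1_le0 ?mulr0//.
have := mulr_ge0_le0 (ler0n R k) (_ : b i - x ord0 i <= 0); rewrite subr_le0 => /(_ h); lra.
Qed.

Lemma bump_gt0 (a b : 'I_n -> R) x : obox a b x -> exists k, 0 < box_bump a b k x.
Proof.
move=> xB; have := @bump_cvg a b x; rewrite indicE mem_set// => /cvgrPdist_lt.
move=> /(_ 1 ltr01) [k _ /(_ k (leqnn _)) /=] H; exists k.
by move: H; rewrite ger0_norm ?subr_ge0 ?bump_le1//; lra.
Qed.

Lemma bump_test (Omega : set 'rV[R]_n) (a b : 'I_n -> R) k : obox a b `<=` Omega ->
  test_function Omega (box_bump a b k).
Proof.
move=> abO.
(* The bump is nonzero only at distance more than 1/k from the faces; the margin 1/(k+1) is smaller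
   and also makes sense for k = 0. *)
pose B : set 'rV[R]_n := [set x | forall i,
  `[a i + k.+1%:R^-1, b i - k.+1%:R^-1]%classic (x ord0 i)].
have k0 : 0 < k.+1%:R^-1 :> R by rewrite invr_gt0.
have cB : compact B.
  apply: (@rV_compact R n (fun i => `[a i + k.+1%:R^-1, b i - k.+1%:R^-1]%classic)) => i.
  exact: segment_compact.
have clB : closed B by apply: compact_closed => //; exact: norm_hausdorff.
have sB : closure [set x | box_bump a b k x != 0] `<=` B.
  have /closure_id -> := clB; apply: closureS => x /= xn0 i.
  have : flat 1 (k%:R * (x ord0 i - a i) - 1) * flat 1 (k%:R * (b i - x ord0 i) - 1) != 0.
    by move/prodf_neq0 : xn0; apply.
  rewrite mulf_eq0 negb_or => /andP[h1 h2].
  have {}h1 : 0 < k%:R * (x ord0 i - a i) - 1 by rewrite -flat1_gt0 lt_def h1 flat1_ge0.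
  have {}h2 : 0 < k%:R * (b i - x ord0 i) - 1 by rewrite -flat1_gt0 lt_def h2 flat1_ge0.
  have kK : (k%:R + 1) * k.+1%:R^-1 = 1 :> R by rewrite natr1 divff.
  have kk : 0 <= k%:R :> R by [].
  rewrite /= in_itv/=; move: (k.+1%:R^-1) k0 kK h1 h2 => j j0.
  move: (k%:R) kk => K K0 Kj h1 h2; apply/andP; split; nra.
split.
- exact/flat_algebra_smooth/flat_algebra_bump.
- by apply: (subclosed_compact _ cB) => //; exact: closed_closure.
- apply: (subset_trans sB) => x Bx; apply: abO => i; have /= := Bx i.
  rewrite !in_itv/= => /andP[h1 h2]; apply/andP; split.
    by apply: lt_le_trans h1; rewrite ltrDl.
  by apply: (le_lt_trans h2); rewrite ltrBlDr ltrDl.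
Qed.

End bump.

(** * The fundamental lemma of the calculus of variations *)

Section fundamental_lemma.
Context (R : realType) (n : nat).
Local Notation mu := (leb R n).
Local Notation box := (@obox R n).

Lemma measurable_obox (a b : 'I_n -> R) : measurable (box a b).
Proof. by apply: (measurable_box (A:=fun i => `]a i, b i[%classic)) => i; exact: measurable_itv. Qed.

Lemma ball_obox (x : 'rV[R]_n) (r : R) : 0 < r ->
  ball x r = box (fun i => x ord0 i - r) (fun i => x ord0 i + r).
Proof.
move=> r0; apply/seteqP; split=> y.
  by move=> [_ H] i; have := H ord0 i; rewrite /= ball_itv.
by move=> H; split=> // i j; rewrite (ord1 i) ball_itv; exact: H.
Qed.

Definition boxes : set (set 'rV[R]_n) := [set B | exists a b, B = box a b].

Lemma boxes_setI : setI_closed boxes.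
Proof.
move=> _ _ [a [b ->]] [c [d ->]].
exists (fun i => Num.max (a i) (c i)), (fun i => Num.min (b i) (d i)).
apply/seteqP; split=> x.
  move=> [H1 H2] i; have := H1 i; have := H2 i; rewrite /= !in_itv/=.
  by rewrite gt_max lt_min => /andP[-> ->] /andP[-> ->].
by move=> H; split=> i; have := H i; rewrite /= !in_itv/= gt_max lt_min;
  move=> /andP[/andP[? ?] /andP[? ?]]; apply/andP.
Qed.

Lemma open_bigcup_balls (A : set 'rV[R]_n) : open A ->
  exists F : nat -> set 'rV[R]_n, A = \bigcup_k F k /\
    forall k, F k = set0 \/ exists x r, [/\ 0 < r, F k = ball x r & ball x r `<=` A].
Proof.
move=> oA.
pose I : countType := ('rV[rat]_n * nat)%type.
pose B (p : I) : set 'rV[R]_n := ball (map_mx ratr p.1 : 'rV[R]_n) p.2.+1%:R^-1.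
exists (fun k => if unpickle k is Some p then if `[< B p `<=` A >] then B p else set0 else set0).
split.
  apply/seteqP; split=> [x Ax|x [k _]].
    have [q [k [qx qA]]] := rational_ball oA Ax.
    exists (pickle ((q, k) : I)) => //; rewrite pickleK asboolT//.
  by case: (unpickle k) => //= p; case: asboolP => // pA; exact: pA.
move=> k; case: (unpickle k) => [p|]; last by left.
case: asboolP => [pA|]; last by left.
by right; exists (map_mx ratr p.1), p.2.+1%:R^-1; split=> //; rewrite invr_gt0.
Qed.

(** Balls are cubes for this norm, and an open set is a countable union of balls. Boxes, unlike
    balls, are stable under intersection, as Dynkin's argument requires. *)
Lemma measurable_boxesE : @measurable _ 'rV[R]_n = <<s boxes >>.
Proof.
apply/seteqP; split.
  apply: smallest_sub; first exact: smallest_sigma_algebra.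
  move=> A oA; have [F [-> FE]] := open_bigcup_balls oA.
  apply: sigma_algebra_bigcup => k; have [->|[x [r [r0 -> _]]]] := FE k.
    exact: sigma_algebra0.
  by apply: sub_sigma_algebra; rewrite ball_obox//; do 2 eexists.
apply: smallest_sub; first exact: sigma_algebra_measurable.
by move=> _ [a [b ->]]; exact: measurable_obox.
Qed.

(** The measurable [A] for which [w] has integral 0 over [A] and [B] together form a Dynkin class.
    Taking [B] to be a box keeps its intersection with any box a box; with a general domain this
    fails. *)
Lemma ae_eq0_of_boxes (B : set 'rV[R]_n) (w : 'rV[R]_n -> R) : boxes B ->
  mu.-integrable B (EFin \o w) ->
  (forall C, boxes C -> C `<=` B -> (\int[mu]_(x in C) (w x)%:E = 0)%E) ->
  ae_eq mu B w (cst 0).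
Proof.
move=> bB wi wC.
have mB : measurable B by have [a [b ->]] := bB; exact: measurable_obox.
have H (A : set 'rV[R]_n) : measurable A -> (\int[mu]_(x in A `&` B) (w x)%:E = 0)%E.
  rewrite {1}measurable_boxesE; move: A.
  apply: (@dynkin_induction _ 'rV[R]_n boxes) => //.
  - exact: measurable_boxesE.
  - exact: boxes_setI.
  - by rewrite setTI; exact: wC.
  - by move=> A bA; apply: wC; [exact: boxes_setI|exact: subIsetr].
  - move=> A mA A0.
    have : (\int[mu]_(x in B) (w x)%:E = 0)%E by exact: wC.
    rewrite -{1}(setTI B) -(setUv A) setIUl integral_setU.
    + by rewrite A0 add0e.
    + exact: measurableI.
    + by apply: measurableI => //; exact: measurableC.
    + rewrite -setIUl setUv setTI; exact: measurable_int wi.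
    + by apply/disj_setPS => x [[Ax _] [nAx _]].
  - move=> F mF tF F0; rewrite setI_bigcupl integral_bigcup.
    + by under eq_eseriesr do rewrite F0; rewrite eseries0.
    + by apply: trivIset_setIr.
    + by move=> k; exact: measurableI.
    + apply: integrableS wi => //; first by apply: bigcup_measurable => k _; exact: measurableI.
      by move=> x [k _ []].
have : ae_eq mu B (EFin \o w) (cst 0%E).
  apply: integral_ae_eq => // E EB mE.
  by rewrite integral0 -(H E mE); congr integral; rewrite setIidl.
by apply: filterS => x h Bx; have [] := h Bx.
Qed.

(** Bumps converge boundedly to the indicator of a box, so by dominated convergence [w] has integral
    0 over each box in the domain. The domain is then covered by countably many balls, and the
    previous lemma applies on each of them. *)
Theorem ae_eq0_of_test_functions (Omega : set 'rV[R]_n) (w : 'rV[R]_n -> R) : open Omega ->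
  mu.-integrable Omega (EFin \o w) ->
  (forall phi, test_function Omega phi -> inner Omega w phi = 0) ->
  ae_eq mu Omega w (cst 0).
Proof.
move=> oO wi wphi.
have mO : measurable Omega by exact: open_measurable_rV.
have boxO C : boxes C -> C `<=` Omega -> (\int[mu]_(x in C) (w x)%:E = 0)%E.
  move=> [a [b ->]] CO.
  have mC := measurable_obox a b.
  pose F k x := (w x * box_bump a b k x)%:E.
  have mbump k : measurable_fun setT (box_bump a b k : 'rV[R]_n -> R).
    by apply: continuous_measurable_rV; apply: flat_algebra_continuous; exact: flat_algebra_bump.
  have mw : measurable_fun Omega w by apply/measurable_EFinP; exact: measurable_int wi.
  have mF k : measurable_fun Omega (F k).
    by apply/measurable_EFinP; apply: measurable_funM => //; exact: measurable_funTS.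
  have Fw k x : Omega x -> (`|F k x| <= `|(w x)%:E|)%E.
    move=> _; rewrite !abse_EFin lee_fin normrM [X in _ * X]ger0_norm ?bump_ge0//.
    by rewrite ler_piMr// bump_le1.
  have Fi k : mu.-integrable Omega (F k) by exact: (le_integrable mO (mF k) (Fw k) wi).
  have F0 k : (\int[mu]_(x in Omega) F k x = 0)%E.
    have := wphi _ (bump_test k CO); rewrite /inner /Rintegral => h.
    have /fineK <- := integrable_fin_num mO (Fi k).
    by rewrite h.
  have Fcvg : (\int[mu]_(x in Omega) F k x)%E @[k --> \oo] -->
      (\int[mu]_(x in Omega) (w x * \1_(obox a b) x)%:E)%E.
    apply: (@dominated_cvg _ _ _ mu Omega mO _ _ (fun x => `|(w x)%:E|)%E) => //.
    - move=> x _; apply/fine_cvgP; split; first exact: nearW.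
      by apply: cvgM; [exact: cvg_cst|exact: bump_cvg].
    - exact: integrable_abse.
  rewrite (_ : (fun k => _) = cst 0%E) in Fcvg; last by apply/funext => k; rewrite F0.
  have /cvg_unique := Fcvg => /(_ _ _ (cvg_cst 0%E)) E.
  have {}E : (\int[mu]_(x in Omega) (w x * \1_(obox a b) x)%:E = 0)%E by exact: E.
  rewrite integral_mkcond -[RHS]E [RHS]integral_mkcond; apply: eq_integral => x _.
  rewrite !patchE indicE; have [xC|xC] := boolP (x \in obox a b).
    by rewrite ifT ?mulr1// inE; apply: CO; exact: set_mem.
  by rewrite mulr0; case: ifP.
have [F [OF FE]] := open_bigcup_balls oO.
have ae k : mu.-negligible (F k `&` [set x | w x != 0]).
  have [->|[x [r [r0 -> FO]]]] := FE k; first by rewrite set0I; exact: negligible_set0.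
  have bB : boxes (ball x r) by rewrite ball_obox//; do 2 eexists.
  have mB : measurable (ball x r) by apply: open_measurable_rV; exact: ball_open.
  have [|N [mN N0 NE]] := @ae_eq0_of_boxes (ball x r) w bB (integrableS mO mB FO wi).
    by move=> C bC CB; apply: boxO => //; exact: subset_trans FO.
  exists N; split=> // y [By /= wy]; apply: NE => /= /(_ By) w0.
  by rewrite w0 eqxx in wy.
have [N [mN N0 NE]] := negligible_bigcup ae.
exists N; split=> // y /= /not_implyP[]; rewrite {1}OF => -[k _ Fy] wy.
by apply: NE; exists k => //; split=> //; exact/eqP.
Qed.

End fundamental_lemma.

(** * Weak derivatives on the domain *)

Section fields_on_domain.
Context (R : realType) (n : nat) (Omega : set 'rV[R]_n).
Hypotheses (oO : open Omega) (bO : bounded_set Omega).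
Local Notation mu := (leb R n).
Local Notation sfield := ('rV[R]_n -> R).
Local Notation vfield := ('rV[R]_n -> 'rV[R]_n).
Implicit Types (f g q phi psi : sfield) (u v w z : vfield).
Local Notation sqi := (sq_integrable mu Omega).
Local Notation inn := (inner Omega).
Local Notation vinn := (vinner Omega).

Lemma measurable_domain : measurable Omega.
Proof. exact: open_measurable_rV. Qed.
Local Notation mO := measurable_domain.

Lemma bounded_set_cube (A : set 'rV[R]_n) : bounded_set A -> exists r, A `<=` cube r.
Proof.
move=> [M [_ H]]; exists (M + 2) => x Ax i.
have := H (M + 1) _ x Ax; rewrite ltrDl ltr01 => /(_ isT) /= xM.
have : ball (0 : 'rV[R]_n) (M + 2) x.
  rewrite mx_norm_ball /ball_ /= sub0r normrN; lra.
by move=> [_ /(_ ord0 i)]; rewrite ball_itv mxE /= !in_itv/= sub0r add0r => /andP[/ltW -> /ltW ->].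
Qed.

Lemma domain_lty : (mu Omega < +oo)%E.
Proof.
have [r Or] := bounded_set_cube bO.
by apply: le_lt_trans (leb_cube_lty n r); apply: le_measure => //; rewrite inE;
  [exact: mO|exact: measurable_cube].
Qed.

Lemma L2P f : L2 Omega f <-> sqi f.
Proof.
split=> [Lf|[mf f2]].
- have fi := Lfun2_integrable_sqr Lf.
  move: Lf; rewrite /L2 /= inE => /andP[]; rewrite inE /= => mf _.
  split; first exact/(measurable_restrictT _ mO).
  apply/(integrable_mkcond _ mO); apply: eq_integrable fi => // x _.
  by rewrite /= !patchE; case: ifP => //; rewrite expr0n.
- rewrite /L2 /= inE; apply/andP; split; rewrite inE /=.
    exact/(measurable_restrictT _ mO).
  rewrite /finite_norm unlock poweR_lty//.
  move/(integrable_mkcond _ mO)/integrableP : f2 => [_].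
  congr (_ < _)%E; apply: eq_integral => x _.
  rewrite /= !patchE; case: ifP => _.
    by rewrite /= powR_mulrn// normrX.
  by rewrite /= -[LHS]/(`|0%:E|%E) -[X in _ = (X `^ 2)%:E]/(`|0|) abse_EFin normr0 powR_mulrn// expr0n.
Qed.

Lemma sqi_cst1 : sqi (cst 1).
Proof.
split; first exact: measurable_cst.
apply: (eq_integrable mO (cst 1%E)) => [x _|]; first by rewrite expr1n.
apply: (measurable_bounded_integrable (f:=cst 1) mO domain_lty); first exact: measurable_cst.
by exists 1; split=> // y /ltW y1 x _; rewrite /= normr1.
Qed.

Lemma integrable_of_sqi f : sqi f -> mu.-integrable Omega (EFin \o f).
Proof.
move=> sf.
have s1 := sqi_cst1.
by apply: eq_integrable (sq_integrableM mO sf s1) => //; [exact: mO|move=> x _ /=; rewrite mulr1].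
Qed.

Local Notation sqv := (vL2 Omega).

Lemma vL2P v i : sqv v -> sqi (fun x => v x ord0 i).
Proof. by move=> /(_ i)/L2P. Qed.

Lemma vinnerE u v : sqv u -> sqv v ->
  vinn u v = \sum_(i < n) inn (fun x => u x ord0 i) (fun x => v x ord0 i).
Proof.
move=> su sv; rewrite /vinner /inner /Rintegral.
under eq_integral do rewrite -sumEFin.
rewrite integral_sum//; last first.
- by move=> i; apply: (sq_integrableM mO); exact: vL2P.
- exact: mO.
rewrite sum_fine//; move=> i _.
by apply: integrable_fin_num => //; [exact: mO|apply: (sq_integrableM mO); exact: vL2P].
Qed.

Lemma sqi_semi_inner : semi_inner (sqi : set (_ -> R)) inn.
Proof. exact (@sq_integrable_semi_inner _ _ R mu Omega mO). Qed.

Lemma vL2_semi_inner : semi_inner (sqv : set ('rV[R]_n -> 'rV[R]_n)) vinn.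
Proof.
have ZD a u v : sqv u -> sqv v -> sqv (a *: u + v).
  move=> su sv i; apply/L2P.
  rewrite (_ : (fun x => _) = (fun x => a * u x ord0 i + v x ord0 i)).
    by apply: (sq_integrableZD mO); exact: vL2P.
  by apply/funext => x; rewrite !mxE.
split => //.
- move=> i; apply/L2P; rewrite (_ : (fun x => _) = (fun=> 0)).
    exact: sq_integrable0.
  by apply/funext => x; rewrite !mxE.
- move=> u v; rewrite /vinner; apply: eq_Rintegral => x _.
  by apply: eq_bigr => i _; rewrite mulrC.
- move=> a u v w su sv sw; rewrite !vinnerE//; last exact: ZD.
  rewrite mulr_sumr -big_split /=; apply: eq_bigr => i _.
  rewrite -(ipZD mO)//; try exact: vL2P.
  by apply: eq_Rintegral => x _; rewrite !mxE.
- move=> u _; apply: Rintegral_ge0 => x _; apply: sumr_ge0 => i _.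
  by rewrite -expr2 sqr_ge0.
Qed.

Lemma test_function_support phi : test_function Omega phi ->
  exists S r, [/\ S `<=` Omega, S `<=` cube r,
    (forall x, ~ S x -> phi x = 0) & (forall x i, ~ S x -> partial i phi x = 0)].
Proof.
move=> [_ cS SO]; have [r Sr] := bounded_set_cube (compact_bounded cS).
exists (closure [set x | phi x != 0]), r; split=> //.
  move=> x Sx; apply/eqP; apply: contrapT => /negP px; apply: Sx.
  exact: subset_closure.
move=> x i Sx; rewrite /partial.
rewrite (near_eq_derive (g:=cst 0)) ?derive_cst//.
have : open (~` closure [set x | phi x != 0]).
  exact/closed_openC/closed_closure.
move=> /(_ x Sx); apply: filterS => y Sy.
apply/eqP; apply: contrapT => /negP px; apply: Sy.
exact: subset_closure.
Qed.

Lemma smooth_derivable phi x (i : 'I_n) : smooth phi -> is_derive x 'e_i phi (partial i phi x).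
Proof. by move=> /(_ [::])[_ h]; apply: derivableP; exact: h. Qed.

Lemma smooth_continuous phi : smooth phi -> continuous phi.
Proof. by move=> /(_ [::])[]. Qed.

Lemma smooth_partial_continuous phi (i : 'I_n) : smooth phi -> continuous (partial i phi).
Proof. by move=> /(_ [:: i])[]. Qed.

Lemma continuous_supported_sqi phi S r : continuous phi -> S `<=` cube r ->
  (forall x, ~ S x -> phi x = 0) -> sqi phi.
Proof.
move=> cphi Sr phi0; split.
  by apply: measurable_funTS; exact: continuous_measurable_rV.
apply: (integrableS measurableT) => //; first exact: mO.
apply: (continuous_cube_integrable (g:=fun x => phi x ^+ 2) (r:=r)).
  move=> x; exact: (continuousM (cphi x) (cphi x)).
by move=> x cx; rewrite phi0 ?expr0n// => /Sr.
Qed.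

Lemma test_sqi phi : test_function Omega phi -> sqi phi.
Proof.
move=> tphi; have [S [r [SO Sr phi0 _]]] := test_function_support tphi.
have cphi : continuous phi by case: tphi => /smooth_continuous.
exact: (continuous_supported_sqi cphi Sr phi0).
Qed.

Lemma test_partial_sqi phi i : test_function Omega phi -> sqi (partial i phi).
Proof.
move=> tphi; have [S [r [SO Sr _ /(_ _ i) phi0]]] := test_function_support tphi.
have cphi : continuous (partial i phi) by case: tphi => /smooth_partial_continuous.
exact: (continuous_supported_sqi cphi Sr phi0).
Qed.

Lemma test_gradient_vL2 phi : test_function Omega phi -> sqv (gradient phi).
Proof.
move=> tphi i; apply/L2P; rewrite (_ : (fun x => _) = partial i phi).
  exact: test_partial_sqi.
by apply/funext => x; rewrite mxE.
Qed.

(** The derivative of the product [phi * psi] has integral 0. Only [psi] needs compact support, so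
    that [phi] can be the constant 1. *)
Lemma inner_partial_test phi psi (i : 'I_n) : smooth phi -> test_function Omega psi ->
  inn phi (partial i psi) = - inn (partial i phi) psi.
Proof.
move=> sphi tpsi; have [S [r [SO Sr psi0 dpsi0]]] := test_function_support tpsi.
have spsi : smooth psi by case: tpsi.
have cphi := smooth_continuous sphi; have cpsi := smooth_continuous spsi.
have dphi := @smooth_partial_continuous _ i sphi.
have dpsi := @smooth_partial_continuous _ i spsi.
have int f : continuous f -> (forall x, ~ S x -> f x = 0) ->
    mu.-integrable setT (EFin \o f).
  by move=> cf f0; apply: (continuous_cube_integrable (r:=r)) => // x cx; apply: f0 => /Sr.
have restr f : (forall x, ~ S x -> f x = 0) -> (\int[mu]_(x in Omega) (f x)%:E = \int[mu]_x (f x)%:E)%E.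
  move=> f0; rewrite integral_mkcond; apply: eq_integral => x _.
  rewrite patchE; case: ifPn => // /negP Ox; rewrite f0// => /SO Ox'.
  by apply: Ox; rewrite inE.
pose g1 x := phi x * partial i psi x; pose g2 x := partial i phi x * psi x.
have g10 x : ~ S x -> g1 x = 0 by move=> Sx; rewrite /g1 dpsi0// mulr0.
have g20 x : ~ S x -> g2 x = 0 by move=> Sx; rewrite /g2 psi0// mulr0.
have i1 := int g1 (fun x => continuousM (cphi x) (dpsi x)) g10.
have i2 := int g2 (fun x => continuousM (dphi x) (cpsi x)) g20.
have E : (\int[mu]_x (g1 x + g2 x)%:E = 0)%E.
  apply: (@integral_partial0 R n i (fun x => phi x * psi x) _ r).
  - by move=> x; exact: (continuousM (cphi x) (cpsi x)).
  - move=> x; apply: (continuousD (f:=g1) (g:=g2)).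
      exact: (continuousM (cphi x) (dpsi x)).
    exact: (continuousM (dphi x) (cpsi x)).
  - move=> x; apply: is_derive_eq (is_deriveM (smooth_derivable x i sphi) (smooth_derivable x i spsi)) _.
    by rewrite -[LHS]/(_ * _ + _ * _) [X in _ + X]mulrC.
  - move=> x cx; have Sx : ~ S x by move=> /Sr.
    by rewrite psi0// mulr0 g10// g20// addr0.
rewrite /inner /Rintegral (restr g1 g10) (restr g2 g20).
apply/eqP; rewrite -addr_eq0 -fineD; [|exact: integrable_fin_num..].
by rewrite -integralD_EFin// E.
Qed.

End fields_on_domain.

Section weak_derivatives.
Context (R : realType) (n : nat) (Omega : set 'rV[R]_n).
Hypotheses (oO : open Omega) (bO : bounded_set Omega).
Local Notation mu := (leb R n).
Local Notation sfield := ('rV[R]_n -> R).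
Local Notation vfield := ('rV[R]_n -> 'rV[R]_n).
Implicit Types (f g q phi psi : sfield) (u v w z : vfield).
Local Notation sqi := (sq_integrable mu Omega).
Local Notation sqv := (vL2 Omega).
Local Notation inn := (inner Omega).
Local Notation vinn := (vinner Omega).
Let mO := measurable_domain oO.

Let LP f := L2P oO f.
Let comp v i (sv : sqv v) := vL2P oO i sv.

Lemma inner_ae f f' g : ae_eq mu Omega f f' -> inn f g = inn f' g.
Proof. by move=> h; apply: ae_eq_Rintegral; apply: filterS h => x H Ox; rewrite H. Qed.

Lemma innerC f g : inn f g = inn g f.
Proof. exact: ipC. Qed.

Lemma vinner_ae v v' w : sqv v -> sqv v' -> sqv w ->
  (forall i, ae_eq mu Omega (fun x => v x ord0 i) (fun x => v' x ord0 i)) ->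
  vinn v w = vinn v' w.
Proof.
by move=> sv sv' sw h; rewrite !(vinnerE oO)//; apply: eq_bigr => i _; exact: inner_ae.
Qed.

Lemma ae_eq_of_inner_test f g : sqi f -> sqi g -> 
  (forall phi, test_function Omega phi -> inn f phi = inn g phi) -> ae_eq mu Omega f g.
Proof.
move=> sf sg fg.
have sd := sq_integrableB mO sf sg.
have H : ae_eq mu Omega (fun x => f x - g x) (cst 0).
  apply: (ae_eq0_of_test_functions oO); first exact: (integrable_of_sqi oO bO).
  move=> phi tphi; have sphi := test_sqi oO tphi.
  rewrite (_ : (fun x => f x - g x) = (-1) *: g + f); last first.
    by apply/funext => x; rewrite -[RHS]/(-1 * g x + f x) mulN1r addrC.
  rewrite (semi_inner_linear (sqi_semi_inner oO))// fg//; ring.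
by apply: filterS H => x h Ox; apply/eqP; rewrite -subr_eq0; apply/eqP/h.
Qed.

Lemma weak_gradient_unique f w w' (i : 'I_n) :
  is_weak_gradient Omega f w -> is_weak_gradient Omega f w' ->
  ae_eq mu Omega (fun x => w x ord0 i) (fun x => w' x ord0 i).
Proof.
move=> [sw H] [sw' H']; apply: ae_eq_of_inner_test; [exact: comp..|].
by move=> phi tphi; apply: oppr_inj; rewrite -H// -H'.
Qed.

Lemma weak_divergence_unique v f f' :
  is_weak_divergence Omega v f -> is_weak_divergence Omega v f' -> ae_eq mu Omega f f'.
Proof.
move=> [/LP sf H] [/LP sf' H']; apply: ae_eq_of_inner_test => // phi tphi.
by apply: oppr_inj; rewrite -H// -H'.
Qed.

Lemma wgradP f : H1 Omega f -> is_weak_gradient Omega f (wgrad Omega f).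
Proof.
by move=> [_ hw]; have := xgetPex (cst 0) hw.
Qed.

Lemma wdivP v : Hdiv Omega v -> is_weak_divergence Omega v (wdiv Omega v).
Proof.
by move=> [_ hf]; have := xgetPex (cst 0) hf.
Qed.

Lemma weak_gradient_smooth phi : smooth phi -> sqv (gradient phi) ->
  is_weak_gradient Omega phi (gradient phi).
Proof.
move=> sphi sg; split=> // psi i tpsi; rewrite (inner_partial_test i sphi tpsi).
by congr (- inner _ _ _); apply/funext => x; rewrite mxE.
Qed.

(** Carrying the weak gradient along with the function replaces H^1 by an honest linear subspace of
    pairs; with [wgrad] the form would be additive only after changes of representative. *)
Definition grad_graph : set (sfield * vfield) :=
  [set p | L2 Omega p.1 /\ is_weak_gradient Omega p.1 p.2].

Definition grad_form (K : R) (p q : sfield * vfield) := inn p.1 q.1 + K * vinn p.2 q.2.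

(** Testing with this pair is what yields zero means, both of the divergence of a field in V and of
    the Riesz representative. *)
Lemma grad_graph_one : grad_graph (cst 1, cst 0).
Proof.
have s1 := sqi_cst1 oO bO.
have g1 : gradient (cst (1 : R)) = cst 0 :> vfield.
  by apply/funext => x; apply/rowP => i; rewrite [LHS]mxE [RHS]mxE /partial derive_cst.
split; first exact/LP.
have sg : sqv (gradient (cst (1 : R))) by rewrite g1; exact: semi_inner0 (vL2_semi_inner oO).
rewrite /= -g1; apply: weak_gradient_smooth => //.
exact/flat_algebra_smooth/flat_algebra_cst.
Qed.

Lemma grad_form_semi_inner (K : R) : 0 < K ->
  semi_inner (grad_graph : set (_ * _)%type) (grad_form K).
Proof.
move=> K0; have Hs := sqi_semi_inner oO; have Hv := vL2_semi_inner oO.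
split.
- split; first by apply/LP; exact: semi_inner0 Hs.
  split; first exact: semi_inner0 Hv.
  move=> phi i tphi; rewrite /inner.
  under eq_Rintegral do rewrite mul0r.
  under [in RHS]eq_Rintegral do rewrite mxE mul0r.
  by rewrite /Rintegral integral0 /= oppr0.
- move=> a [f w] [g z] [/LP sf [sw H]] [/LP sg [sz H']] /=.
  split; first by apply/LP; exact: (semi_innerZD Hs).
  split; first exact: (semi_innerZD Hv).
  move=> phi i tphi /=; have sphi := test_sqi oO tphi.
  have sd := test_partial_sqi oO i tphi.
  have -> : (fun x => (a *: w + z) x ord0 i) =
      a *: (fun x => w x ord0 i) + (fun x => z x ord0 i).
    by apply/funext => x; rewrite !mxE.
  rewrite !(semi_inner_linear Hs)//; try exact: comp.
  by rewrite H// H'//; ring.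
- by move=> p q; rewrite /grad_form innerC (semi_innerC Hv).
- move=> a [f w] [g z] [h y] [/LP sf [sw _]] [/LP sg [sz _]] [/LP sh [sy _]].
  rewrite /grad_form /= (semi_inner_linear Hs)// (semi_inner_linear Hv)//; ring.
- move=> [f w] [/LP sf [sw _]]; rewrite /grad_form addr_ge0 ?mulr_ge0 ?(ltW K0)//.
    exact: (semi_inner_ge0 Hs).
  exact: (semi_inner_ge0 Hv).
Qed.

End weak_derivatives.

(** * Completeness of H^1 and solution of the regularized problem *)

Section grad_complete.
Context (R : realType) (n : nat) (Omega : set 'rV[R]_n).
Hypotheses (oO : open Omega) (bO : bounded_set Omega).
Local Notation mu := (leb R n).
Local Notation sfield := ('rV[R]_n -> R).
Local Notation vfield := ('rV[R]_n -> 'rV[R]_n).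
Local Notation sqi := (sq_integrable mu Omega).
Local Notation sqv := (vL2 Omega).
Local Notation inn := (inner Omega).
Local Notation vinn := (vinner Omega).
Let mO := measurable_domain oO.
Let LP f := L2P oO f.
Let comp v i (sv : sqv v) := vL2P oO i sv.
Let Hs := sqi_semi_inner oO.
Let Hv := vL2_semi_inner oO.

Lemma inner_le_vinner v (i : 'I_n) : sqv v ->
  inn (fun x => v x ord0 i) (fun x => v x ord0 i) <= vinn v v.
Proof.
move=> sv; rewrite (vinnerE oO)// (bigD1 i)//= lerDl sumr_ge0// => j _.
by apply: (semi_inner_ge0 Hs); exact: comp.
Qed.

(** The weak gradient is a closed operator: its defining identities pass to L^2 limits by
    Cauchy-Schwarz. *)
Lemma eq_inner_lim (f : nat -> sfield) (f0 : sfield) (g : nat -> sfield) (g0 : sfield)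
    (phi psi : sfield) : sqi phi -> sqi psi ->
  (forall k, sqi (f k)) -> (forall k, sqi (g k)) -> sqi f0 -> sqi g0 ->
  (forall e : R, 0 < e -> exists N, forall k, (N <= k)%N -> inn (f k - f0) (f k - f0) < e) ->
  (forall e : R, 0 < e -> exists N, forall k, (N <= k)%N -> inn (g k - g0) (g k - g0) < e) ->
  (forall k, inn (f k) phi = - inn (g k) psi) -> inn f0 phi = - inn g0 psi.
Proof.
move=> sphi spsi sf sg sf0 sg0 ff gg fg.
apply/eqP; rewrite -subr_eq0 opprK -sqrf_eq0; apply/eqP/le_anti; rewrite sqr_ge0 andbT.
apply/ler_addgt0Pl => e e0; rewrite addr0.
pose c := inn phi phi + inn psi psi + 1.
have phi0 := semi_inner_ge0 Hs sphi; have psi0 := semi_inner_ge0 Hs spsi.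
have c0 : 0 < 4 * c by rewrite mulr_gt0// /c; lra.
have e'0 : 0 < e / (4 * c) by rewrite divr_gt0.
have [N1 N1E] := ff _ e'0; have [N2 N2E] := gg _ e'0.
pose k := maxn N1 N2.
have {N1E} := N1E k (leq_maxl _ _); have {N2E} := N2E k (leq_maxr _ _).
have sB := semi_inner_stableB Hs.
have c1 := semi_inner_CauchySchwarz Hs (sB _ _ (sf k) sf0) sphi.
have c2 := semi_inner_CauchySchwarz Hs (sB _ _ (sg k) sg0) spsi.
rewrite (semi_innerBl Hs (z:=phi))// in c1; rewrite (semi_innerBl Hs (z:=psi))// in c2.
have := fg k.
have p1 := semi_inner_ge0 Hs (sB _ _ (sf k) sf0).
have p2 := semi_inner_ge0 Hs (sB _ _ (sg k) sg0).
rewrite !ltr_pdivlMr//.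
move: (inn (f k - f0) (f k - f0)) (inn (g k - g0) (g k - g0)) p1 p2 c1 c2.
move: (inn (f k) phi) (inn (g k) psi) (inn f0 phi) (inn g0 psi) => a b a0 b0 p q p0 q0 c1 c2 E h1 h2; subst a.
have {}c1 : (- b - a0) ^+ 2 <= p * c by apply: (le_trans c1); apply: ler_wpM2l => //; rewrite /c; lra.
have {}c2 : (b - b0) ^+ 2 <= q * c by apply: (le_trans c2); apply: ler_wpM2l => //; rewrite /c; lra.
have := sqr_ge0 ((- b - a0) - (b - b0)); nra.
Qed.

Lemma grad_form_complete (K : R) : 0 < K ->
  semi_inner_complete (grad_graph Omega : set (_ * _)%type) (grad_form Omega K).
Proof.
move=> K0 u Mu cauchy.
have sf k : sqi (u k).1 by have [/LP] := Mu k.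
have sw k : sqv (u k).2 by have [_ []] := Mu k.
have sBf j k : sqi ((u j).1 - (u k).1) by exact: sq_integrableB.
have sBw j k : sqv ((u j).2 - (u k).2).
  by rewrite addrC -scaleN1r; exact: (semi_innerZD Hv).
have f_cauchy (e : R) : 0 < e -> exists N, forall j k, (N <= j)%N -> (N <= k)%N ->
    inn ((u j).1 - (u k).1) ((u j).1 - (u k).1) < e.
  move=> e0; have [N NE] := cauchy e e0; exists N => j k Nj Nk.
  apply: le_lt_trans (NE j k Nj Nk); rewrite lerDl mulr_ge0 ?(ltW K0)//.
  exact: (semi_inner_ge0 Hv (sBw j k)).
have w_cauchy (i : 'I_n) (e : R) : 0 < e -> exists N, forall j k, (N <= j)%N -> (N <= k)%N ->
    inn ((fun x => (u j).2 x ord0 i) - (fun x => (u k).2 x ord0 i))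
        ((fun x => (u j).2 x ord0 i) - (fun x => (u k).2 x ord0 i)) < e.
  move=> e0; have [|N NE] := cauchy (K * e); first exact: mulr_gt0.
  exists N => j k Nj Nk; rewrite -(ltr_pM2l K0); apply: le_lt_trans (NE j k Nj Nk).
  apply: (@le_trans _ _ (K * vinn ((u j).2 - (u k).2) ((u j).2 - (u k).2))).
    rewrite ler_pM2l//.
    have -> : (fun x => (u j).2 x ord0 i) - (fun x => (u k).2 x ord0 i) =
       (fun x => ((u j).2 - (u k).2) x ord0 i) by apply/funext => x; rewrite !mxE.
    exact: inner_le_vinner.
  by rewrite lerDr; exact: (semi_inner_ge0 Hs (sBf _ _)).
have [f sf0 fE] := riesz_fischer mO sf f_cauchy.
have ex (i : 'I_n) : exists w, sqi w /\ forall e : R, 0 < e -> exists N, forall k, (N <= k)%N ->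
    inn ((fun x => (u k).2 x ord0 i) - w) ((fun x => (u k).2 x ord0 i) - w) < e.
  by have [w sw0 wE] := riesz_fischer mO (fun k => comp i (sw k)) (w_cauchy i); exists w.
have [w wE] := choice ex.
pose w0 : vfield := fun x => \row_i w i x.
have w0E i : (fun x => w0 x ord0 i) = w i by apply/funext => x; rewrite mxE.
have sw0 : sqv w0 by move=> i; apply/LP; rewrite w0E; case: (wE i).
exists (f, w0).
  split; [exact/LP|split=> // phi i tphi].
  rewrite /= w0E; apply: (@eq_inner_lim (fun k => (u k).1) f (fun k x => (u k).2 x ord0 i)) => //.
  - exact: test_partial_sqi.
  - exact: test_sqi.
  - by move=> k; exact: comp.
  - by case: (wE i).
  - by case: (wE i).
  - by move=> k; have [_ [_]] := Mu k; apply.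
move=> e e0.
(* The n components together contribute at most K n d, which is strictly below e/2 thanks to n + 1
   in place of n, also for n = 0. *)
pose d := e / (2 * K * n.+1%:R).
have d0 : 0 < d by rewrite divr_gt0// !mulr_gt0.
have [|N1 N1E] := fE (e / 2); first by rewrite divr_gt0.
have [N2 N2E] := choice (fun i => (proj2 (wE i)) d d0).
exists (maxn N1 (\sum_i N2 i)%N) => k; rewrite geq_max => /andP[k1 k2].
have sd : sqv ((u k).2 - w0) by rewrite addrC -scaleN1r; exact: (semi_innerZD Hv).
rewrite /grad_form /=.
have h1 := N1E k k1.
have h2 : vinn ((u k).2 - w0) ((u k).2 - w0) <= n%:R * d.
  rewrite (vinnerE oO)// mulr_natl -[X in _ *+ X]card_ord -sumr_const; apply: ler_sum => i _.
  have -> : (fun x => ((u k).2 - w0) x ord0 i) = (fun x => (u k).2 x ord0 i) - w i.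
    by apply/funext => x; rewrite !mxE.
  apply/ltW/N2E; apply: leq_trans k2.
  by rewrite (bigD1 i)//= leq_addr.
have h3 : K * (n%:R * d) < e / 2.
  have -> : K * (n%:R * d) = (e / 2) * (n%:R / n.+1%:R).
    by rewrite /d; field; rewrite lt0r_neq0// gt_eqF//.
  rewrite gtr_pMr ?divr_gt0// ltr_pdivrMr// mul1r ltr_nat//.
rewrite [ltRHS]splitr; apply: ltrD; first exact: h1.
exact: le_lt_trans (ler_wpM2l (ltW K0) h2) h3.
Qed.

Lemma darcy_solution (K : R) (q : sfield) : 0 < K -> L2 Omega q ->
  exists2 p, grad_graph Omega p &
    forall r, grad_graph Omega r -> grad_form Omega K p r = inn q r.1.
Proof.
move=> K0 /LP sq.
have HB := grad_form_semi_inner oO K0.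
apply: (riesz HB (l:=fun r => inn q r.1) (c:=inn q q)) => //.
- exact: grad_form_complete.
- move=> a r s [/LP sr _] [/LP ss _].
  by rewrite innerC /= (semi_inner_linear Hs)// !(innerC _ q).
- move=> r [/LP sr [sz _]].
  apply: (le_trans (semi_inner_CauchySchwarz Hs sq sr)).
  rewrite ler_wpM2l ?(semi_inner_ge0 Hs)// lerDl mulr_ge0 ?(ltW K0)//.
  exact: (semi_inner_ge0 Hv sz).
Qed.

End grad_complete.

(** * The Brezzi conditions *)

Section brezzi.
Context (R : realType) (n : nat) (Omega : set 'rV[R]_n).
Hypothesis oO : open Omega.
Local Notation mu := (leb R n).
Local Notation sfield := ('rV[R]_n -> R).
Local Notation vfield := ('rV[R]_n -> 'rV[R]_n).
Implicit Types (f g q x y phi psi : sfield) (u v w z : vfield).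
Local Notation sqi := (sq_integrable mu Omega).
Local Notation sqv := (vL2 Omega).
Local Notation inn := (inner Omega).
Local Notation vinn := (vinner Omega).
Let LP f := L2P oO f.
Let Hs := sqi_semi_inner oO.
Let Hv := vL2_semi_inner oO.
Variables (K : R) (K01 : 0 < K < 1).
Local Notation V := (V_space Omega K).
Local Notation Q := (Q_space Omega K).
Let K0 : 0 < K. Proof. by case/andP: K01. Qed.

Lemma normr_le_mul (a b c : R) : 0 <= b -> 0 <= c -> a ^+ 2 <= b ^+ 2 * c ^+ 2 -> `|a| <= b * c.
Proof.
move=> b0 c0 abc; rewrite -(@ler_pXn2r _ 2) ?nnegrE ?mulr_ge0//.
by rewrite real_normK ?num_real// exprMn.
Qed.

Lemma V_spaceP v : carrier V v ->
  [/\ sqv v, is_weak_divergence Omega v (wdiv Omega v) &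
      forall f, H1 Omega f -> normal_trace Omega v f = 0].
Proof. by move=> [sv [hv nv]]; split=> //; exact: wdivP. Qed.

Lemma wdiv_sqi v : carrier V v -> sqi (wdiv Omega v).
Proof. by move=> /V_spaceP[_ [/LP]]. Qed.

Lemma V_norm_ge0 v : 0 <= norm V v.
Proof. exact: sqrtr_ge0. Qed.

Lemma V_norm_sqr v : carrier V v ->
  norm V v ^+ 2 = K^-1 * vinn v v + (vinn v v + inn (wdiv Omega v) (wdiv Omega v)).
Proof.
move=> cv; have [sv _ _] := V_spaceP cv.
have v0 := semi_inner_ge0 Hv sv; have d0 := semi_inner_ge0 Hs (wdiv_sqi cv).
rewrite /= sqr_sqrtr ?addr_ge0 ?sqr_ge0//.
by rewrite exprMn exprVn !sqr_sqrtr ?addr_ge0 ?(ltW K0).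
Qed.

Definition Q_energy (xy : sfield * sfield) : R :=
  inn xy.1 xy.1 + K * vinn (wgrad Omega xy.2) (wgrad Omega xy.2).

Definition Q_decomposition q (xy : sfield * sfield) :=
  [/\ carrier (L2_zero_mean Omega) xy.1, carrier (H1_zero_mean Omega) xy.2 &
      ae_eq mu Omega q (xy.1 \+ xy.2)].

Lemma Q_energyE xy : carrier (L2_zero_mean Omega) xy.1 -> carrier (H1_zero_mean Omega) xy.2 ->
  norm (L2_zero_mean Omega) xy.1 ^+ 2 +
  norm (scale_space (Num.sqrt K) (H1_zero_mean Omega)) xy.2 ^+ 2 = Q_energy xy.
Proof.
move=> [/LP sx _] [hy _]; have [sw _] := wgradP hy.
by rewrite /= exprMn !sqr_sqrtr ?(ltW K0) ?(semi_inner_ge0 Hs sx) ?(semi_inner_ge0 Hv sw).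
Qed.

Lemma Q_energy_ge0 q xy : Q_decomposition q xy -> 0 <= Q_energy xy.
Proof.
by case=> cx cy _; rewrite -Q_energyE// addr_ge0// sqr_ge0.
Qed.

Lemma Q_normE q : norm Q q = Num.sqrt (inf [set Q_energy xy | xy in Q_decomposition q]).
Proof.
rewrite /=; congr (Num.sqrt (inf _)); apply/seteqP; split=> t [xy [cx cy e] <-];
  by exists xy => //; rewrite -Q_energyE.
Qed.

Lemma Q_norm_sqr q :
  norm Q q ^+ 2 = inf [set Q_energy xy | xy in Q_decomposition q].
Proof.
rewrite Q_normE sqr_sqrtr//.
(* Outside [Q] there is no decomposition, and the infimum of the empty set is 0 by convention. *)
have [->|/set0P S0] := eqVneq [set Q_energy xy | xy in Q_decomposition q] set0.
  by rewrite inf0.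
by apply: lb_le_inf => // _ [xy /Q_energy_ge0 H <-].
Qed.

Lemma Q_norm_sqr_le q xy : Q_decomposition q xy -> norm Q q ^+ 2 <= Q_energy xy.
Proof.
move=> qxy; rewrite Q_norm_sqr; apply: ge_inf; last by exists xy.
by exists 0 => _ [xy' /Q_energy_ge0 H <-].
Qed.

Lemma le_Q_norm_sqr q c : carrier Q q ->
  (forall xy, Q_decomposition q xy -> c <= Q_energy xy) -> c <= norm Q q ^+ 2.
Proof.
move=> [xy cq] H; rewrite Q_norm_sqr; apply: lb_le_inf; first by exists (Q_energy xy), xy.
by move=> _ [xy' /H h <-].
Qed.

Lemma darcy_aE u v : sqv u -> sqv v -> darcy_a Omega K u v = K^-1 * vinn u v.
Proof. by move=> su sv; rewrite -(semi_innerZ Hv). Qed.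

Lemma continuous_a u v : carrier V u -> carrier V v ->
  `|darcy_a Omega K u v| <= 1 * norm V u * norm V v.
Proof.
move=> cu cv; have [su _ _] := V_spaceP cu; have [sv _ _] := V_spaceP cv.
move: (V_norm_ge0 u) (V_norm_ge0 v) (V_norm_sqr cu) (V_norm_sqr cv).
move: (norm V u) (norm V v) => nu nv nu0 nv0 eu ev.
rewrite mul1r; apply: normr_le_mul => //; rewrite darcy_aE// eu ev exprMn.
have Ki : 0 < K^-1 by rewrite invr_gt0.
have := semi_inner_ge0 Hs (wdiv_sqi cu); have := semi_inner_ge0 Hs (wdiv_sqi cv).
have := semi_inner_ge0 Hv su; have := semi_inner_ge0 Hv sv.
have := semi_inner_CauchySchwarz Hv su sv.
move: (K^-1) Ki (vinn u u) (vinn v v) (vinn u v) (inn _ _) (inn _ _) => k k0 a b c d e.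
move=> cab b0 a0 e0 d0.
apply: (@le_trans _ _ ((k * a) * (k * b))).
  have -> : k * a * (k * b) = k ^+ 2 * (a * b) by ring.
  exact: (ler_wpM2l (sqr_ge0 k) cab).
by apply: ler_pM; rewrite ?mulr_ge0 ?(ltW k0)// lerDl addr_ge0.
Qed.

(** Cauchy-Schwarz in the plane with weights K^-1 and K that cancel in the product; the cross terms
    [s] and [t] dominate 2 A B by the inequality of means. It matches the weights of V against those
    of Q, whence the constant 1 in (ii). *)
Lemma le_sqr_young (A B D X W G : R) : 0 <= D -> 0 <= X -> 0 <= W -> 0 <= G ->
  A ^+ 2 <= D * X -> B ^+ 2 <= W * G -> (A + B) ^+ 2 <= (D + K^-1 * W) * (X + K * G).
Proof.
move=> D0 X0 W0 G0 hA hB.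
have Ki : 0 < K^-1 by rewrite invr_gt0.
have -> : (D + K^-1 * W) * (X + K * G) = D * X + W * G + (D * (K * G) + X * (K^-1 * W)).
  by field; rewrite lt0r_neq0.
set s := D * (K * G); set t := X * (K^-1 * W).
have s0 : 0 <= s by rewrite /s !mulr_ge0 ?(ltW K0).
have t0 : 0 <= t by rewrite /t !mulr_ge0 ?(ltW Ki).
have st : s * t = (D * X) * (W * G) by rewrite /s /t; field; rewrite lt0r_neq0.
have AB : (A * B) ^+ 2 <= s * t by rewrite st exprMn ler_pM ?sqr_ge0.
have : 2 * (A * B) <= s + t.
  case: (lerP (2 * (A * B)) (s + t)) => // h.
  have : (s + t) ^+ 2 < (2 * (A * B)) ^+ 2 by rewrite ltr_pXn2r ?nnegrE//; lra.
  have := sqr_ge0 (s - t); nra.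
rewrite sqrrD; lra.
Qed.

Lemma continuous_b_sqr v q : carrier V v -> carrier Q q ->
  darcy_b Omega v q ^+ 2 <= norm V v ^+ 2 * norm Q q ^+ 2.
Proof.
move=> cv cq; have [sv _ nv] := V_spaceP cv; have sd := wdiv_sqi cv.
have step xy : Q_decomposition q xy -> darcy_b Omega v q ^+ 2 <= norm V v ^+ 2 * Q_energy xy.
  case: xy => x y [[/= /LP sx _] [hy _] qxy].
  have [/LP sy _] := hy; have [sw _] := wgradP hy.
  (* Vanishing normal trace moves the divergence onto the H^1 part of the decomposition. *)
  have -> : darcy_b Omega v q = inn (wdiv Omega v) x + - vinn v (wgrad Omega y).
    rewrite /darcy_b innerC (inner_ae _ qxy).
    have := semi_inner_linear Hs 1 sx sy sd; rewrite scale1r mul1r => ->.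
    rewrite innerC; congr (_ + _); have := nv y hy; rewrite /normal_trace.
    by rewrite innerC => /eqP; rewrite addr_eq0 => /eqP ->; rewrite opprK.
  have v0 := semi_inner_ge0 Hv sv; have d0 := semi_inner_ge0 Hs sd.
  have x0 := semi_inner_ge0 Hs sx; have w0 := semi_inner_ge0 Hv sw.
  have c1 := semi_inner_CauchySchwarz Hs sd sx.
  have c2 := semi_inner_CauchySchwarz Hv sv sw.
  rewrite -sqrrN in c2.
  apply: (le_trans (le_sqr_young d0 x0 v0 w0 c1 c2)).
  move: (norm V v ^+ 2) (V_norm_sqr cv) => nv2 ->.
  apply: ler_wpM2r; first by rewrite addr_ge0// mulr_ge0// ltW.
  lra.
(* Passing from every decomposition to the infimum divides by the norm of [v]; if it is 0, a single
   decomposition suffices. *)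
have [Vz|Vn] := eqVneq (norm V v ^+ 2) 0.
  have [xy cxy] := cq; have := step xy cxy.
  by rewrite Vz !mul0r.
have Vp : 0 < norm V v ^+ 2 by rewrite lt_def Vn sqr_ge0.
rewrite mulrC -ler_pdivrMr//; apply: le_Q_norm_sqr => // xy cxy.
by rewrite ler_pdivrMr// mulrC; exact: step.
Qed.

Lemma continuous_b v q : carrier V v -> carrier Q q ->
  `|darcy_b Omega v q| <= 1 * norm V v * norm Q q.
Proof.
move=> cv cq; rewrite mul1r.
by apply: normr_le_mul; [exact: V_norm_ge0|exact: sqrtr_ge0|exact: continuous_b_sqr].
Qed.

End brezzi.

(** * Coercivity on the kernel and the inf-sup witness *)

Section brezzi_lower.
Context (R : realType) (n : nat) (Omega : set 'rV[R]_n).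
Hypotheses (oO : open Omega) (bO : bounded_set Omega).
Local Notation mu := (leb R n).
Local Notation sfield := ('rV[R]_n -> R).
Local Notation vfield := ('rV[R]_n -> 'rV[R]_n).
Implicit Types (f g q x y phi psi : sfield) (u v w z : vfield).
Local Notation sqi := (sq_integrable mu Omega).
Local Notation sqv := (vL2 Omega).
Local Notation inn := (inner Omega).
Local Notation vinn := (vinner Omega).
Let LP f := L2P oO f.
Let Hs := sqi_semi_inner oO.
Let Hv := vL2_semi_inner oO.
Variables (K : R) (K01 : 0 < K < 1).
Local Notation V := (V_space Omega K).
Local Notation Q := (Q_space Omega K).
Let K0 : 0 < K. Proof. by case/andP: K01. Qed.
Let K1 : K < 1. Proof. by case/andP: K01. Qed.

Lemma inner1 f : inn f (cst 1) = \int[mu]_(x in Omega) f x.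
Proof. by apply: eq_Rintegral => x _; rewrite mulr1. Qed.

Lemma H1_of_grad_graph p : grad_graph Omega p -> H1 Omega p.1.
Proof. by move=> [Lp gp]; split=> //; exists p.2. Qed.

Lemma vinner_wgrad f v w : is_weak_gradient Omega f w -> sqv v ->
  vinn (wgrad Omega f) v = vinn w v.
Proof.
move=> gw sv; have gf : is_weak_gradient Omega f (wgrad Omega f).
  by have := xgetPex (cst 0) (ex_intro _ w gw).
apply: (vinner_ae oO) => //; [by case: gf|by case: gw|move=> i].
exact: (weak_gradient_unique oO bO i gf gw).
Qed.

Lemma wdiv_ae v f : is_weak_divergence Omega v f -> ae_eq mu Omega (wdiv Omega v) f.
Proof.
move=> df; have dv : is_weak_divergence Omega v (wdiv Omega v).
  by have := xgetPex (cst 0) (ex_intro _ f df).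
exact: (weak_divergence_unique oO bO dv df).
Qed.

Lemma H1_zero_mean0 : carrier (H1_zero_mean Omega) (cst 0).
Proof.
have g0 := semi_inner0 (grad_form_semi_inner oO K0).
split; first exact: (H1_of_grad_graph g0).
by rewrite /zero_mean /= /Rintegral integral0.
Qed.

(** The normal trace tested against the constant 1 is the integral of the divergence. *)
Lemma wdiv_zero_mean v : carrier V v -> zero_mean Omega (wdiv Omega v).
Proof.
move=> cv; have [sv _ nv] := V_spaceP cv.
have g1 := grad_graph_one oO bO.
rewrite /zero_mean /= -inner1; have := nv _ (H1_of_grad_graph g1).
rewrite /normal_trace (semi_innerC Hv) (vinner_wgrad (proj2 g1))//=.
rewrite -[X in vinn X v](scale0r (cst 0 : vfield)).
rewrite (semi_innerZ Hv)//; last exact: (semi_inner0 Hv).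
by rewrite mul0r add0r.
Qed.

(** The divergence of [z] has zero mean, hence lies in Q and may be taken as [q]: it has norm 0.
    What remains is (K^-1 + 1) |z|^2 <= 2 K^-1 |z|^2, since K < 1. *)
Lemma coercive_a z : Z_space Omega K z -> 2^-1 * norm V z ^+ 2 <= darcy_a Omega K z z.
Proof.
move=> [cz bz]; have [sz dz _] := V_spaceP cz.
have cd : carrier Q (wdiv Omega z).
  exists (wdiv Omega z, cst 0); split.
  - by split; [case: dz|exact: wdiv_zero_mean].
  - exact: H1_zero_mean0.
  - by apply: aeW => t _ /=; rewrite addr0.
have := bz _ cd; rewrite /darcy_b => d0.
move: (norm V z ^+ 2) (V_norm_sqr oO K01 cz) => nz2 ->.
rewrite (darcy_aE oO)// d0 addr0.
have z0 := semi_inner_ge0 Hv sz.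
have Ki : 1 <= K^-1 by rewrite invf_ge1// ltW.
nra.
Qed.

Lemma inf_sup_witness q : carrier Q q ->
  exists v, [/\ carrier V v, norm Q q ^+ 2 <= darcy_b Omega v q,
    norm V v ^+ 2 <= 2 * darcy_b Omega v q &
    v = cst 0 %[ae mu in Omega] -> darcy_b Omega v q = 0].
Proof.
move=> [[x1 y1] [[/LP sx1 zx1] [hy1 zy1] /= qxy]].
have [/LP sy1 _] := hy1.
(* [q] itself may fail to be measurable; the Riesz problem is posed for this square-integrable
   representative. *)
pose q' := x1 + y1.
have sq' : sqi q' by have := semi_innerZD Hs 1 sx1 sy1; rewrite scale1r.
have s1 : sqi (cst 1) by case: (grad_graph_one oO bO) => /LP.
have zq' : inn q' (cst 1) = 0.
  have := semi_inner_linear Hs 1 sx1 sy1 s1; rewrite scale1r mul1r !inner1 => ->.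
  by move: zx1 zy1; rewrite /zero_mean /= => -> ->; rewrite addr0.
have [[y w] [/LP /= sy gw] yw] := darcy_solution oO K0 (proj2 (LP q') sq').
have sw : sqv w by case: gw.
have hy : H1 Omega y by split; [exact/LP|exists w].
have zy : inn y (cst 1) = 0.
  rewrite -zq' -(yw _ (grad_graph_one oO bO)) /grad_form /=.
  rewrite -[X in vinn w X](scale0r (cst 0 : vfield)) (semi_innerC Hv).
  rewrite (semi_innerZ Hv)//; last exact: (semi_inner0 Hv).
  by rewrite mul0r mulr0 addr0.
pose D := q' - y.
have sD : sqi D by exact: (semi_inner_stableB Hs).
pose v : vfield := (- K) *: w.
have sv : sqv v by exact: (semi_inner_stableZ Hv).
have dv : is_weak_divergence Omega v D.
  split; first exact/LP.
  move=> phi tphi.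
  have sphi := test_sqi oO tphi; have sg := test_gradient_vL2 oO tphi.
  have gphi : grad_graph Omega (phi, gradient phi).
    by split; [exact/LP|apply: weak_gradient_smooth => //; case: tphi].
  have := yw _ gphi; rewrite /grad_form /= => E.
  by rewrite (semi_innerZ Hv)// (semi_innerBl Hs)// -E; ring.
have aeD := wdiv_ae dv.
have nv f : H1 Omega f -> normal_trace Omega v f = 0.
  move=> hf; have [/LP sf _] := hf; have gf := wgradP hf.
  rewrite /normal_trace (inner_ae _ aeD).
  have := yw (f, wgrad Omega f) (conj (proj2 (LP f) sf) gf); rewrite /grad_form /= => E.
  by rewrite (semi_innerZ Hv)//; [rewrite (semi_innerBl Hs)// -E; ring|case: gf].
have cv : carrier V v.
  by split=> //; split; [split=> //; exists D|exact: nv].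
have w0 := semi_inner_ge0 Hv sw; have D0 := semi_inner_ge0 Hs sD.
(* Here (D, q') = (D, D) + (D, y), and testing the Riesz identity with y itself gives (D, y) = K
   |w|^2. *)
have bE : darcy_b Omega v q = inn D D + K * vinn w w.
  rewrite /darcy_b (inner_ae _ aeD) innerC (inner_ae (f' := q') _ qxy).
  have gy : grad_graph Omega (y, w) by split=> //; exact/LP.
  have := yw _ gy; rewrite /grad_form /= => E.
  rewrite [inn D D](semi_innerBl Hs)//.
  have -> : inn y D = inn q' y - inn y y by rewrite innerC (semi_innerBl Hs).
  by rewrite -E; ring.
exists v; split=> //.
- have -> : darcy_b Omega v q = Q_energy Omega K (D, y).
    rewrite bE /Q_energy /= (vinner_wgrad gw); last by case: (wgradP hy).
    by rewrite (semi_innerC Hv) (vinner_wgrad gw).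
  apply: (Q_norm_sqr_le oO K01); split.
  + split; first exact/LP.
    by rewrite /zero_mean /= -inner1 (semi_innerBl Hs)// zq' zy subr0.
  + by split=> //; rewrite /zero_mean /= -inner1.
  + by apply: filterS qxy => t h Ot; rewrite (h Ot) /= /D -[RHS]/(q' t - y t + y t) subrK.
- move: (norm V v ^+ 2) (V_norm_sqr oO K01 cv) => nv2 ->; rewrite bE.
  have -> : vinn v v = K ^+ 2 * vinn w w.
    by rewrite (semi_innerZ Hv)// (semi_innerC Hv) (semi_innerZ Hv)//; ring.
  rewrite (inner_ae _ aeD) innerC (inner_ae _ aeD).
  have -> : K^-1 * (K ^+ 2 * vinn w w) = K * vinn w w by field; rewrite lt0r_neq0.
  (* The squared norm of [v] is K |w|^2 + K^2 |w|^2 + |D|^2; as K < 1 the middle term is at most the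
     first, hence the factor 2. *)
  have : K ^+ 2 * vinn w w <= K * vinn w w.
    by apply: ler_wpM2r => //; rewrite expr2 ler_piMr// ltW.
  move: D0; lra.
- move=> v_ae; rewrite /darcy_b.
  (* [wdiv] of an almost everywhere zero field is only some representative; uniqueness identifies it
     with 0 almost everywhere. *)
  have d0 : is_weak_divergence Omega v (cst 0).
    split; first by apply/LP; exact: semi_inner0 Hs.
    move=> phi tphi; have sg := test_gradient_vL2 oO tphi.
    rewrite (vinner_ae oO (v' := cst 0) sv (semi_inner0 Hv) sg); last first.
      by move=> i; apply: filterS v_ae => t h Ot; rewrite h.
    rewrite -[X in vinn X _](scale0r (cst 0 : vfield)).
    rewrite (semi_innerZ Hv)//; last exact: (semi_inner0 Hv).
    rewrite mul0r -[X in inn X _](scale0r (cst 0 : sfield)).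
    rewrite (semi_innerZ Hs)//; [by rewrite mul0r oppr0|exact: semi_inner0 Hs|].
    exact: test_sqi.
  rewrite (inner_ae _ (wdiv_ae d0)) /inner; under eq_Rintegral do rewrite mul0r.
  by rewrite /Rintegral integral0.
Qed.

End brezzi_lower.

(** * A nonzero field in V *)

Section nonzero_field.
Context (R : realType) (n : nat) (Omega : set 'rV[R]_n).
Hypotheses (oO : open Omega) (bO : bounded_set Omega).
Local Notation mu := (leb R n).
Local Notation sfield := ('rV[R]_n -> R).
Local Notation vfield := ('rV[R]_n -> 'rV[R]_n).
Implicit Types (f g q phi psi : sfield) (u v w z : vfield).
Local Notation sqi := (sq_integrable mu Omega).
Local Notation sqv := (vL2 Omega).
Local Notation inn := (inner Omega).
Local Notation vinn := (vinner Omega).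

Lemma leb_ball_gt0 (x : 'rV[R]_n) (r : R) : 0 < r -> (0 < mu (ball x r))%E.
Proof.
move=> r0; rewrite ball_obox// (leb_box
  (A:=fun i => `]x ord0 i - r, x ord0 i + r[%classic)) => [|i]; last exact: measurable_itv.
elim/big_ind : _ => //.
  by move=> s t s0 t0; exact: mule_gt0.
move=> i _; rewrite lebesgue_measure_itv /= lte_fin.
rewrite ifT; last lra.
by rewrite -EFinB lte_fin; lra.
Qed.

Definition axis_field phi (i : 'I_n) : vfield := fun x => phi x *: 'e_i.

Lemma axis_field_component phi i x j : axis_field phi i x ord0 j = phi x * (j == i)%:R.
Proof. by rewrite !mxE. Qed.

Lemma vinner_axis_field phi i v : vinn (axis_field phi i) v = inn phi (fun x => v x ord0 i).
Proof.
apply: eq_Rintegral => x _; rewrite (bigD1 i)//= big1 ?addr0.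
  by rewrite axis_field_component eqxx mulr1.
by move=> j ji; rewrite axis_field_component (negbTE ji) mulr0 mul0r.
Qed.

(** Its weak divergence is the i-th partial derivative of [phi], and its normal trace against f is
    zero by the very definition of the weak gradient of f tested with [phi]. *)
Lemma axis_field_in_V (K : R) phi i : test_function Omega phi ->
  carrier (V_space Omega K) (axis_field phi i).
Proof.
move=> tphi; have [sphi _ _] := tphi.
have sv : sqv (axis_field phi i).
  move=> j; apply/(L2P oO).
  rewrite (_ : (fun x => _) = (j == i)%:R *: phi).
    exact: (semi_inner_stableZ (sqi_semi_inner oO) _ (test_sqi oO tphi)).
  by apply/funext => x; rewrite axis_field_component mulrC.
have dv : is_weak_divergence Omega (axis_field phi i) (partial i phi).
  split; first by apply/(L2P oO); exact: test_partial_sqi.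
  move=> psi tpsi; rewrite vinner_axis_field -(inner_partial_test i sphi tpsi).
  by congr inner; apply/funext => x; rewrite mxE.
split=> //; split; first by split=> //; exists (partial i phi).
move=> f hf; rewrite /normal_trace vinner_axis_field (inner_ae _ (wdiv_ae oO bO dv)).
have [_ gf] := wgradP hf.
by rewrite [X in _ + X]innerC gf// [X in _ - X]innerC subrr.
Qed.

(** Makes the set in the supremum of (iv) nonempty; an empty supremum would be minus infinity. A
    bump is positive near a point of the domain, and balls have positive measure. *)
Lemma exists_nonzero_field (K : R) (i : 'I_n) : Omega !=set0 ->
  exists v, carrier (V_space Omega K) v /\ ~ (v = cst 0 %[ae mu in Omega]).
Proof.
move=> [x0 Ox0].
have /nbhs_ballP[e /= e0 eO] : nbhs x0 Omega by exact: open_nbhs_nbhs.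
pose a j := x0 ord0 j - e; pose b j := x0 ord0 j + e.
have abO : obox a b `<=` Omega by rewrite -ball_obox.
have [|k pk] := @bump_gt0 R n a b x0; first by rewrite -ball_obox//; exact: ballxx.
pose phi := box_bump a b k : 'rV[R]_n -> R.
have tphi : test_function Omega phi by exact: bump_test.
exists (axis_field phi i); split; first exact: axis_field_in_V.
have cphi : continuous phi by case: tphi => /smooth_continuous.
have : nbhs x0 ((phi @^-1` [set t | 0 < t]) `&` Omega).
  apply: filterI; last exact: open_nbhs_nbhs.
  by apply: cphi; apply: open_nbhs_nbhs; split => //; exact: open_gt.
move=> /nbhs_ballP[r /= r0 rphi] [N [mN N0 NE]].
have : (mu (ball x0 r) <= mu N)%E.
  apply: le_measure; rewrite ?inE//; first by apply: open_measurable_rV; exact: ball_open.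
  move=> y /rphi[/= py Oy]; apply: NE => /= /(_ Oy) /(congr1 (fun v : 'rV[R]_n => v ord0 i)).
  by rewrite axis_field_component eqxx mulr1 mxE => p0; rewrite p0 ltxx in py.
by rewrite N0 leNgt leb_ball_gt0.
Qed.

End nonzero_field.

Theorem proposition1 (R : realType) (n : nat) (hn : n = 2%N \/ n = 3%N)
    (Omega : set 'rV[R]_n) (hOmega : bounded_lipschitz_domain Omega) :
  exists Ca Cb alpha beta : R,
    [/\ 0 < Ca, 0 < Cb, 0 < alpha & 0 < beta] /\
    forall K : R, 0 < K < 1 ->
    let V := V_space Omega K in
    let Q := Q_space Omega K in
    [/\ (forall u v, carrier V u -> carrier V v ->
           `|darcy_a Omega K u v| <= Ca * norm V u * norm V v),
        (forall v q, carrier V v -> carrier Q q ->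
           `|darcy_b Omega v q| <= Cb * norm V v * norm Q q),
        (forall z, Z_space Omega K z ->
           alpha * norm V z ^+ 2 <= darcy_a Omega K z z) &
        (forall q, carrier Q q ->
           (beta * norm Q q)%:E <=
           ereal_sup [set (darcy_b Omega v q / norm V v)%:E | v in
             [set v | carrier V v /\ ~ (v = cst 0%R %[ae leb R n in Omega])]])%E].
Proof.
have oO := domain_open hOmega; have bO := domain_bounded hOmega.
have n0 : (0 < n)%N by case: hn => ->.
exists 1, 1, 2^-1, 2^-1; split; first by split; rewrite ?invr_gt0.
move=> K K01 V Q; split.
- by move=> u v; exact: continuous_a.
- by move=> v q; exact: continuous_b.
- by move=> z; exact: coercive_a.
move=> q cq.
have [v0 [cv0 v0n]] := exists_nonzero_field oO bO K (Ordinal n0) (domain_nonempty hOmega).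
have [v [cv qb vb v_ae]] := inf_sup_witness oO bO K01 cq.
have Q0 : 0 <= norm Q q by exact: sqrtr_ge0.
have cb0 := continuous_b oO K01 cv0 cq; have cb := continuous_b oO K01 cv cq.
move: (norm Q q) Q0 qb cb cb0 => nq Q0 qb cb cb0.
(* If [q] has norm 0, the inf-sup witness may be zero; any nonzero [v0] gives the quotient 0 by
   continuity of b. *)
have [qz|qn] := eqVneq nq 0.
  move: cb0; rewrite qz !mulr0 normr_le0 => /eqP b0.
  apply: (@le_trans _ _ (darcy_b Omega v0 q / norm V v0)%:E).
    by rewrite lee_fin b0 mul0r.
  apply: ereal_sup_ubound.
  exists v0; last by reflexivity.
  exact: (conj cv0 v0n).
have qp : 0 < nq ^+ 2 by rewrite exprn_gt0// lt_def qn.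
have bp : 0 < darcy_b Omega v q by exact: lt_le_trans qb.
apply: (@le_trans _ _ (darcy_b Omega v q / norm V v)%:E); last first.
  apply: ereal_sup_ubound; exists v; last by reflexivity.
  by apply: (conj cv) => /v_ae b0; rewrite b0 ltxx in bp.
have V0 : 0 <= norm V v by exact: V_norm_ge0.
rewrite lee_fin; move: (norm V v) V0 vb cb => nv V0 vb cb.
(* Continuity of b excludes norm 0, since b(v, q) is positive. *)
have Vp : 0 < nv.
  rewrite lt_def V0 andbT; apply/eqP => v00; move: cb.
  by rewrite v00 mulr0 mul0r normr_le0 => /eqP b0; rewrite b0 ltxx in bp.
rewrite ler_pdivlMr//; move: (darcy_b Omega v q) qb vb bp => b qb vb bp {v_ae cb cb0}.
(* nq nv <= (nq^2 + nv^2)/2 <= (b + 2 b)/2, so half of the product is at most 3 b/4. The constant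
   1/2 leaves this slack and avoids square roots. *)
have := sqr_ge0 (nq - nv); rewrite sqrrB -mulr_natl; lra.
Qed.
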